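(* Let $\rho=(\rho_1,\rho_2,\ldots)$ be a fixed sequence of integers with $\rho_j\ge1$, and let $\Pi$ be a constrained exchangeable partition of $\mathbb N$ (with respect to $\rho$), with restrictions $\Pi_n=\Pi|_{[n]}$. Then the normalised shapes $\mathrm{shape}(\Pi_n)/n$, considered as sequences padded by infinitely many zeroes, converge in the product topology as $n\to\infty$, with probability one, to some random limit $(P_1,P_2,\ldots)$ satisfying $P_j\ge0$ and $\sum_jP_j\le1$. Conditionally given $(P_k)$, the partition $\Pi$ is obtained by successive extension of $\Pi_n$ to $\Pi_{n+1}$, for $n=1,2,\ldots$, according to the following rules: given $\Pi_n$ with $\mathrm{shape}(\Pi_n)=(\lambda_1,\ldots,\lambda_\ell)$ and blocks $B_1,\ldots,B_\ell$, the element $n+1$ (i) joins the block $B_j$, $j<\ell$, with probability $P_j$; (ii) if $\lambda_\ell<\rho_\ell$, joins the block $B_\ell$ with probability $1-\sum_{j=1}^{\ell-1}P_j$; (iii) if $\lambda_\ell\ge\rho_\ell$, joins the block $B_\ell$ with probability $P_\ell$ or starts the new block $B_{\ell+1}$ with probability $1-\sum_{j=1}^{\ell}P_j$.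
   Context: A partition of $\mathbb N$ (or of $[n]=\{1,\ldots,n\}$) is a sequence $(b_1,b_2,\ldots)$ of disjoint subsets with union $\mathbb N$ (resp. $[n]$) such that $b_k=\varnothing$ implies $b_{k+1}=\varnothing$, and $b_{k+1}\neq\varnothing$ implies $\min b_k<\min b_{k+1}$. A random partition $\Pi=(B_k)$ of $\mathbb N$ is identified with the consistent sequence of its restrictions $\Pi_n=\Pi|_{[n]}$; $\Pi_1$ has the single block $\{1\}$. A partition $(b_k)$ is constrained (with respect to $\rho$) if for every $k$ with $b_k\ne\varnothing$ the block $b_k$ contains the $\rho_k$ least elements of $\bigcup_{j\ge k}b_j$ (all its elements, if there are fewer than $\rho_k$ of them). The shape of a partition of $[n]$ is the finite sequence of the sizes $\#b_1,\#b_2,\ldots$ of its nonempty blocks. A random partition $\Pi$ of $\mathbb N$ is constrained exchangeable if $\Pi$ is constrained with respect to $\rho$ and its law is invariant under all bijections that preserve this property. Equivalently, for every $n$, $\mathbb P(\Pi_n=\pi)=\mathbb P(\Pi_n=\pi')$ whenever $\pi=(b_1,b_2,\ldots)$ and $\pi'=(\sigma(b_1),\sigma(b_2),\ldots)$ are both constrained partitions of $[n]$, for some bijection $\sigma:[n]\to[n]$. *)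

(* Defs.v *)
(* MathComp-Analysis.

   Conventions.  Elements and block indices are counted from 0: the natural
   number i stands for the element i+1 of {1, 2, ...}, so that [n] is `I_n and
   the element n+1 is n; blocks b_1, b_2, ... are b 0, b 1, ...; and rho_1,
   rho_2, ... are rho 0, rho 1, ... *)
From HB Require Import structures.
From mathcomp Require Import all_boot all_order all_algebra finmap.
From mathcomp Require Import all_classical all_reals all_analysis.

Set Implicit Arguments.
Unset Strict Implicit.
Unset Printing Implicit Defensive.
Import Order.TTheory GRing.Theory Num.Theory.
Import numFieldNormedType.Exports.

Local Open Scope classical_set_scope.
Local Open Scope ring_scope.

(* Only meant for nonempty sets: the default value is 0. *)
Definition minset_nat (A : set nat) : nat :=
  xget 0%N [set m | A m /\ forall i, A i -> (m <= i)%N].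

(* [b] is a partition of [A]; past the last nonempty block, [b] is set0. *)
Definition ordered_partition (A : set nat) (b : nat -> set nat) : Prop :=
  [/\ trivIset setT b,
      \bigcup_k b k = A,
      (forall k, b k = set0 -> b k.+1 = set0) &
      (forall k, b k.+1 !=set0 ->
         (minset_nat (b k) < minset_nat (b k.+1))%N)].

(* The [r] least elements of [A] (all of [A] if it has fewer than [r]): those
   elements of [A] preceded by fewer than [r] elements of [A]. *)
Definition least_elements (r : nat) (A : set nat) : set nat :=
  [set i | A i /\ (#|` fset_set (A `&` `I_i)| < r)%N].

Definition constrained (rho : nat -> nat) (b : nat -> set nat) : Prop :=
  forall k, b k !=set0 ->
    least_elements (rho k) (\bigcup_(j in [set j | (k <= j)%N]) b j) `<=` b k.

(* Since blocks are listed by increasing minima, intersecting each block with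
   [n] leaves no empty block before a nonempty one: no reindexing is needed. *)
Definition restriction (n : nat) (b : nat -> set nat) : nat -> set nat :=
  fun k => b k `&` `I_n.

(* For a partition [b] of `I_n, which has at most n nonempty blocks. *)
Definition partition_shape (n : nat) (b : nat -> set nat) : seq nat :=
  [seq s <- mkseq (fun k => #|` fset_set (b k)|) n | (0 < s)%N].

Definition normalised_shape (R : realType) (n : nat) (b : nat -> set nat) :
    nat -> R :=
  fun j => (nth 0%N (partition_shape n b) j)%:R / n%:R.

Definition random_partition (d : measure_display) (T : measurableType d)
    (Pi : T -> nat -> set nat) : Prop :=
  (forall w, ordered_partition setT (Pi w)) /\
  (forall (n : nat) (pi : nat -> set nat),
     measurable [set w | restriction n (Pi w) = pi]).

Definition constrained_exchangeable (d : measure_display)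
    (T : measurableType d) (R : realType) (P : probability T R)
    (rho : nat -> nat) (Pi : T -> nat -> set nat) : Prop :=
  {ae P, forall w, constrained rho (Pi w)} /\
  (forall (n : nat) (sigma : nat -> nat) (pi : nat -> set nat),
     set_bij `I_n `I_n sigma ->
     let pi' := fun k => sigma @` pi k in
     ordered_partition `I_n pi -> constrained rho pi ->
     ordered_partition `I_n pi' -> constrained rho pi' ->
     P [set w | restriction n (Pi w) = pi] =
     P [set w | restriction n (Pi w) = pi']).

(* [f] is a version of the conditional probability of [E] given the
   sub-sigma-algebra [G]. *)
Definition is_cond_prob (d : measure_display) (T : measurableType d)
    (R : realType) (P : probability T R) (G : set (set T)) (E : set T)
    (f : T -> R) : Prop :=
  [/\ (forall Y : set R, measurable Y -> G (f @^-1` Y)),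
      P.-integrable setT (EFin \o f) &
      (forall B, G B -> (\int[P]_(w in B) (f w)%:E)%E = P (E `&` B))].

(* The sigma-algebra generated by X 0, X 1, ... and by the restriction of Pi
   to [n], which takes finitely many values. *)
Definition sigma_limit_restriction (d : measure_display)
    (T : measurableType d) (R : realType) (X : nat -> T -> R)
    (Pi : T -> nat -> set nat) (n : nat) : set (set T) :=
  <<s [set A | (exists (j : nat) (Y : set R),
                  measurable Y /\ A = X j @^-1` Y) \/
               (exists pi : nat -> set nat,
                  A = [set w | restriction n (Pi w) = pi])] >>.

(* Probability that the next element is put in block j (0-based), given a
   nonempty shape lambda and frequencies p.  With l := size lambda the index of
   the last nonempty block is l.-1, and j = l is the new block. *)
Definition extension_prob (R : realType) (rho : nat -> nat) (p : nat -> R)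
    (lambda : seq nat) (j : nat) : R :=
  let l := size lambda in
  let last_full := (rho l.-1 <= nth 0 lambda l.-1)%N in
  if (j < l.-1)%N then p j
  else if j == l.-1 then
    if last_full then p j else 1 - \sum_(i < l.-1) p i
  else if (j == l) && last_full then 1 - \sum_(i < l) p i
  else 0.

(* Main.v *)
(* Encode a partition by the function [a] sending an element to the index of its
   block.  Once block j contains its first rho_j elements, transposing the
   adjacent elements i and i+1, one of which lies in block j, yields another
   constrained partition of the same shape, so it preserves probabilities.
   Hence from that moment on the indicators of the events that i joins block j
   have constant first and mixed second moments, and for n <= m their means over
   the first n and over the first m terms are at L2-distance at most 1/sqrt n:
   this gives almost sure convergence along n = k^4, hence along all n.

   For the conditional law, let B be an event that is determined by the limit
   frequencies and Pi_n.  Such a B lies in the sigma-algebra generated by the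
   cylinder events invariant under the transposition (i i+1), for every i >= n.
   So, if block j contains its first rho_j elements on B, then P(i joins j, B)
   does not depend on i >= n; averaging over i and passing to the limit, it
   equals the integral of P_j over B.  The remaining probability goes to the
   single other block that n may join. *)
Require Import Defs.
From HB Require Import structures.
From mathcomp Require Import all_boot all_order all_algebra finmap.
From mathcomp Require Import all_classical all_reals all_analysis.
From mathcomp Require Import measurable_realfun zify ring lra.

Set Implicit Arguments.
Unset Strict Implicit.
Unset Printing Implicit Defensive.
Import Order.TTheory GRing.Theory Num.Theory.
Import numFieldNormedType.Exports.

Local Open Scope classical_set_scope.

(** * Constrained partitions as restricted growth functions *)

Definition block_index (b : nat -> set nat) (i : nat) : nat :=
  xget 0 [set k | b k i].

Definition blocks (n : nat) (a : nat -> nat) (k : nat) : set nat :=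
  [set i | i < n /\ a i = k].

Definition block_size (a : nat -> nat) (k n : nat) : nat :=
  \sum_(t < n) (a t == k).

(** The label version of [constrained]: it is tested one element at a time and looks only at the
    past. When [rho] is positive it also forces new labels to appear in order. *)
Definition admissible (rho a : nat -> nat) (n : nat) : Prop :=
  forall i, i < n -> forall k, k < a i -> rho k <= block_size a k i.

(** The trace on labels of listing the blocks by increasing minima. *)
Definition restricted_growth (a : nat -> nat) : Prop :=
  forall i k, k < a i -> exists2 t, t < i & a t = k.

Definition swap (i : nat) (t : nat) : nat :=
  if t == i then i.+1 else if t == i.+1 then i else t.

Lemma swapK i : involutive (swap i).
Proof.
move=> t; rewrite /swap; have [->|ti] := eqVneq t i.
  by rewrite eqxx gtn_eqF.
by have [->|/negPf->] := eqVneq t i.+1; rewrite ?eqxx ?(negPf ti).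
Qed.

Lemma swap_lt n i t : i.+1 < n -> (swap i t < n) = (t < n).
Proof. by rewrite /swap => ?; case: eqP => ?; [|case: eqP => ?]; lia. Qed.

Lemma swap_id i t : t < i -> swap i t = t.
Proof. by rewrite /swap => ?; case: eqP => ?; [|case: eqP => ?]; lia. Qed.

Lemma swapL i : swap i i = i.+1.
Proof. by rewrite /swap eqxx. Qed.

Lemma swapR i : swap i i.+1 = i.
Proof. by rewrite /swap eqxx; case: ifPn => // ?; lia. Qed.

Lemma swap_gt i t : i.+1 < t -> swap i t = t.
Proof. by rewrite /swap => ?; case: eqP => ?; [|case: eqP => ?]; lia. Qed.

Lemma block_sizeS a k n : block_size a k n.+1 = block_size a k n + (a n == k).
Proof. by rewrite /block_size big_ord_recr. Qed.

Lemma block_size_le a k n : block_size a k n <= n.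
Proof.
elim: n => [|n IH]; first by rewrite /block_size big_ord0.
by rewrite block_sizeS -addn1 leq_add// leq_b1.
Qed.

Lemma leq_block_size a k m n : m <= n -> block_size a k m <= block_size a k n.
Proof.
move=> /subnKC <-; elim: (n - m) => [|p IH]; first by rewrite addn0.
by rewrite addnS block_sizeS (leq_trans IH)// leq_addr.
Qed.

Lemma eq_block_size a a' k n :
  (forall t, t < n -> a t = a' t) -> block_size a k n = block_size a' k n.
Proof. by move=> aa'; apply: eq_bigr => t _; rewrite aa'. Qed.

Lemma block_size_gt0 a k n : 0 < block_size a k n -> exists2 t, t < n & a t = k.
Proof.
elim: n => [|n IH]; first by rewrite /block_size big_ord0.
rewrite block_sizeS; case: (eqVneq (a n) k) => [<- _|_]; first by exists n.
by rewrite addn0 => /IH[t tn <-]; exists t => //; exact: ltnW.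
Qed.

Lemma block_size_swap_le a k i n : n <= i ->
  block_size (a \o swap i) k n = block_size a k n.
Proof.
by move=> ni; apply: eq_block_size => t tn /=; rewrite swap_id// (leq_trans tn).
Qed.

Lemma block_size_swap a k i n : i.+1 < n ->
  block_size (a \o swap i) k n = block_size a k n.
Proof.
elim: n => // n IH; rewrite ltnS leq_eqVlt => /predU1P[<-|ltin].
  rewrite !block_sizeS /= swapL swapR block_size_swap_le//.
  by rewrite -!addnA; congr addn; rewrite addnC.
by rewrite !block_sizeS IH //= swap_gt.
Qed.

Lemma block_size_swapS a k i :
  block_size a k i <= block_size (a \o swap i) k i.+1.
Proof. by rewrite block_sizeS block_size_swap_le// leq_addr. Qed.

(* Elements of [b_j] have no effect on the constraints once [b_j] contains its
   first [rho j] elements, so they may be moved past any other element. *)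
Lemma admissible_swap rho a i j n : (forall k, 0 < rho k) -> i.+1 < n ->
  rho j <= block_size a j i -> a i = j \/ a i.+1 = j ->
  admissible rho a n -> admissible rho (a \o swap i) n.
Proof.
move=> rho0 iN full aij adm t tN k /=.
have [lti|] := ltnP t i.
  by rewrite swap_id // block_size_swap_le ?(ltnW lti)//; exact: adm.
rewrite leq_eqVlt => /predU1P[<-|]; last first.
  rewrite leq_eqVlt => /predU1P[<-|ltit].
    rewrite swapR => ka; apply: leq_trans (block_size_swapS _ _ _).
    by apply: adm => //; lia.
  by rewrite swap_gt// block_size_swap//; exact: adm.
rewrite swapL block_size_swap_le// => ka.
have := adm _ iN _ ka; rewrite block_sizeS.
have [aik|] := eqVneq (a i) k; last by rewrite addn0.
(* Now i itself lies in block k. If i lies in block j, then k = j is full. Otherwise i+1 lies in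
   block j, so k < j; block j already has an element t' < i, and block k had to be full before
   t'. *)
move=> _; case: aij => aij; first by rewrite -aik aij.
have [t' t'i at'] := block_size_gt0 (leq_trans (rho0 _) full).
apply: leq_trans (leq_block_size _ _ (ltnW t'i)).
by apply: adm; rewrite ?at' -?aij//; lia.
Qed.

(** * Correspondence between ordered partitions and label functions *)

Lemma minset_natP (A : set nat) : A !=set0 ->
  A (minset_nat A) /\ forall i, A i -> minset_nat A <= i.
Proof.
move=> [i Ai]; rewrite /minset_nat.
have exA : exists n, `[< A n >] by exists i; exact/asboolP.
case: (ex_minnP exA) => m /asboolP Am minm.
have /(xgetPex 0)// : exists m, [set m | A m /\ forall i, A i -> m <= i] m.
by exists m; split => // k Ak; apply: minm; exact/asboolP.
Qed.

Lemma card_fset_set_ltn (A : set nat) n :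
  #|` fset_set (A `&` `I_n)| = \sum_(t < n) `[< A t >].
Proof.
have -> : fset_set (A `&` `I_n) = seq_fset tt [seq t <- iota 0 n | `[< A t >]].
  apply/fsetP => t; rewrite seq_fsetE mem_filter mem_iota/= add0n.
  rewrite in_fset_set; last exact: finite_setIr.
  apply/idP/andP; rewrite inE/= => -[].
    by move=> At tn; split => //; exact/asboolP.
  by move=> /asboolP.
rewrite size_seq_fset undup_id ?filter_uniq ?iota_uniq// size_filter.
rewrite -sum1_count big_mkcond/= -{1}[n]subn0 -/(index_iota 0 n) big_mkord.
by apply: eq_bigr => t _; case: asbool.
Qed.

Section ordered_partition_index.
Variables (A : set nat) (b : nat -> set nat).
Hypothesis bA : ordered_partition A b.

Lemma block_indexP k i : A i -> b k i <-> block_index b i = k.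
Proof.
move=> Ai; have [tb bigb _ _] := bA.
have [k' bk'] : exists k', b k' i.
  by move: Ai; rewrite -bigb => -[k' _ ?]; exists k'.
have bi : b (block_index b i) i.
  by apply: (@xgetPex _ 0 [set k | b k i]); exists k'.
by split=> [bk|<-//]; apply: tb => //; exists i; split.
Qed.

Lemma block_indexE k i : b k i -> A i /\ block_index b i = k.
Proof.
move=> bk; have Ai : A i by have [_ <- _ _] := bA; exists k.
by split => //; apply/block_indexP.
Qed.

(** Descent through the minima: the least element of block l precedes that of block l+1, hence
    precedes every element of block l+1. *)
Lemma block_index_earlier i k : A i -> k < block_index b i ->
  exists2 t, t < i & A t /\ block_index b t = k.
Proof.
move=> Ai; have [tb bigb _ bmin] := bA.
have : b (block_index b i) i by apply/block_indexP.
move: {1 2}(block_index b i) => l.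
elim: l i Ai => // l IH i Ai bl.
have bl0 : b l.+1 !=set0 by exists i.
have [_ /(_ _ bl)ml] := minset_natP bl0.
have lt := bmin _ bl0.
have bl' : b l !=set0.
  have [_ _ bemp _] := bA.
  by apply/set0P/eqP => /bemp E; move/set0P: bl0; rewrite E eqxx.
have [bml _] := minset_natP bl'.
have [Aml al] := block_indexE bml.
rewrite ltnS leq_eqVlt => /predU1P[->|kl].
  by exists (minset_nat (b l)) => //; lia.
have [t ti [At atk]] := IH _ Aml bml kl.
by exists t => //; lia.
Qed.

End ordered_partition_index.

Lemma restricted_growth_index b :
  ordered_partition setT b -> restricted_growth (block_index b).
Proof. by move=> bT i k /(block_index_earlier bT I)[t ti [_ tk]]; exists t. Qed.

Lemma restriction_blocks n b : ordered_partition setT b ->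
  restriction n b = blocks n (block_index b).
Proof.
move=> bT; apply/funext => k; apply/seteqP; split=> i /=.
  by move=> [/(block_indexE bT)[_ <-]].
by move=> [ni <-]; split => //; exact/(block_indexP bT).
Qed.

Lemma eq_blocks n a a' :
  blocks n a = blocks n a' <-> (forall t, t < n -> a t = a' t).
Proof.
split=> [E t tn|E].
  have : blocks n a (a t) t by split.
  by rewrite E => -[].
apply/funext => k; apply/seteqP; split => t [tn <-];
  by split => //; rewrite E.
Qed.

Lemma card_blocks a k n : #|` fset_set (blocks n a k)| = block_size a k n.
Proof.
have -> : blocks n a k = [set t | a t = k] `&` `I_n.
  by apply/seteqP; split => t [].
rewrite card_fset_set_ltn; apply: eq_bigr => t _.
by congr nat_of_bool; apply/asboolP/eqP.
Qed.

(** Let m be the least element of the blocks after k, so m <= i. If block k had fewer than [rho k]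
    elements before i, then m would be preceded by fewer than [rho k] elements of the blocks from k
    on, all of them in block k. The constraint would then put m into block k. *)
Lemma constrained_admissible rho b n : ordered_partition setT b ->
  constrained rho b -> admissible rho (block_index b) n.
Proof.
move=> bT cb i _ k ka.
pose later := \bigcup_(j in [set j | k < j]) b j.
have later0 : later !=set0.
  by exists i, (block_index b i) => //; exact/(block_indexP bT).
have [[l kl blm] minm] := minset_natP later0.
set m := minset_nat later in blm minm.
have mi : m <= i.
  by apply: minm; exists (block_index b i) => //; exact/(block_indexP bT).
rewrite leqNgt; apply/negP => lt.
have bk0 : b k !=set0.
  have [t _ [_ <-]] := block_index_earlier bT I ka.
  by exists t; exact/(block_indexP bT).
have : b k m.
  apply: (cb k bk0); split; first by exists l => //; exact: ltnW.
  apply: leq_ltn_trans lt; rewrite -card_blocks.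
  have -> : blocks i (block_index b) k = [set t | block_index b t = k] `&` `I_i.
    by apply/seteqP; split => t [].
  rewrite !card_fset_set_ltn.
  apply: (@leq_trans (\sum_(t < m) `[< block_index b t = k >])).
    apply: leq_sum => t _; case: asboolP => // -[j kj bj].
    case: asboolP => // tk; exfalso.
    have /minm : later t.
      exists j => //=; rewrite ltn_neqAle kj andbT; apply/eqP => jk.
      by apply: tk; rewrite jk; apply/(block_indexP bT).
    by rewrite leqNgt ltn_ord.
  rewrite (big_ord_widen i (fun t => nat_of_bool `[< block_index b t = k >])) //.
  by rewrite big_mkcond; apply: leq_sum => t _; case: ifP.
move=> /(block_indexP bT _ I) mk; move/(block_indexP bT _ I): blm => ml.
by move: kl; rewrite /= -mk ml ltnn.
Qed.

Section admissible_blocks.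
Variables (rho a : nat -> nat) (n : nat).
Hypothesis rho0 : forall k, 0 < rho k.
Hypothesis adm : admissible rho a n.

Lemma admissible_earlier i k : i < n -> k < a i -> exists2 t, t < i & a t = k.
Proof. by move=> ni /(adm ni) le; apply: block_size_gt0; apply: leq_trans le. Qed.

Lemma ordered_partition_blocks : ordered_partition `I_n (blocks n a).
Proof.
split.
- by move=> j k _ _ [i [[_ <-] [_ <-]]].
- apply/seteqP; split => [i [k _ []]//|i ni]; by exists (a i).
- move=> k; apply: contraPP => /eqP/set0P[i [ni ai]].
  have [|t ti at'] := @admissible_earlier i k ni; first by rewrite ai.
  by apply/eqP/set0P; exists t; split => //; apply: ltn_trans ni.
- move=> k k0; have [[ni ai] _] := minset_natP k0.
  have [|t ti at'] := @admissible_earlier _ k ni; first by rewrite ai.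
  have tk : blocks n a k t by split => //; exact: ltn_trans ni.
  exact: leq_ltn_trans ((minset_natP (ex_intro _ t tk)).2 _ tk) ti.
Qed.

(** An element of a block after k is preceded by [rho k] elements of block k, so it is not among the
    [rho k] least elements of the blocks from k on. *)
Lemma constrained_blocks : constrained rho (blocks n a).
Proof.
move=> k _ i [[j kj [ni ai]] lt]; split => //.
apply/eqP; rewrite ai eqn_leq kj andbT leqNgt; apply/negP => {}kj.
move: lt; rewrite ltnNge => /negP; apply.
have := adm ni; rewrite ai => /(_ _ kj) /leq_trans; apply.
rewrite card_fset_set_ltn; apply: leq_sum => t _.
case: eqP => // atk; case: asboolP => // H; exfalso; apply: H.
by exists k => //=; split => //; apply: ltn_trans ni.
Qed.

End admissible_blocks.

Lemma image_swap_blocks i n a : i.+1 < n ->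
  (fun k => swap i @` blocks n a k) = blocks n (a \o swap i).
Proof.
move=> iN; apply/funext => k; apply/seteqP; split => t /=.
  by move=> [t' [tn' <-] <-]; split; rewrite /= ?swap_lt// swapK.
move=> [tn at']; exists (swap i t); last exact: swapK.
by split => //; rewrite swap_lt.
Qed.

Lemma swap_bij i n : i.+1 < n -> set_bij `I_n `I_n (swap i).
Proof.
move=> iN; split.
- by move=> t /=; rewrite swap_lt.
- by move=> t t' _ _ /(can_inj (@swapK i)).
- by move=> t /= tn; exists (swap i t); rewrite /= ?swap_lt ?swapK.
Qed.

(** * Shapes in terms of label counts *)

Section shape.
Variables (a : nat -> nat) (n : nat).
Hypothesis a_rg : restricted_growth a.

(** Hence the first n labels are all below n, and finitely many words describe the restrictions to
    [n]. *)
Lemma restricted_growth_le i : a i <= i.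
Proof.
move: {2}(a i) (leqnn (a i)) => l.
elim: l i => [|l IH] i; first lia.
rewrite leq_eqVlt => /predU1P[al|/IH//].
have /a_rg[t ti tl] : l < a i by rewrite al.
by rewrite al -{1}tl (leq_ltn_trans _ ti)// IH// tl.
Qed.

Lemma block_size_prev k : 0 < block_size a k.+1 n -> 0 < block_size a k n.
Proof.
move=> /block_size_gt0[t tn atk].
have /a_rg[t' tt' atk'] : k < a t by rewrite atk.
rewrite /block_size (bigD1 (Ordinal (ltn_trans tt' tn)))//=.
by rewrite atk' eqxx.
Qed.

Lemma block_size_after k : n <= k -> block_size a k n = 0.
Proof.
move=> nk; rewrite /block_size big1// => t _; apply/eqP; rewrite eqb0.
apply/eqP => atk; have := restricted_growth_le t; rewrite atk.
by have := ltn_ord t; lia.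
Qed.

(** The nonempty blocks form an initial segment of the indices, so the filter in [partition_shape]
    only drops trailing zeros and shifts no index. Here l is the first index of an empty block. *)
Lemma partition_shapeE :
  exists2 l, partition_shape n (blocks n a) = mkseq (fun k => block_size a k n) l
  & l <= n /\ forall k, (k < l) = (0 < block_size a k n).
Proof.
have exl : exists l, block_size a l n == 0 by exists n; rewrite block_size_after.
case: (ex_minnP exl) => l /eqP l0 lmin.
have ln : l <= n by apply: lmin; rewrite block_size_after.
have kl k : (k < l) = (0 < block_size a k n).
  apply/idP/idP => [kl|].
    by rewrite lt0n; apply/negP => /lmin; rewrite leqNgt kl.
  apply: contraTT; rewrite -leqNgt => /subnKC <-; rewrite -eqn0Ngt.
  elim: (k - l) => [|p IH]; first by rewrite addn0 l0.
  rewrite addnS; apply: contraTT IH; rewrite -!lt0n => /block_size_prev //.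
exists l; last by split.
rewrite /partition_shape.
under eq_mkseq do rewrite card_blocks.
rewrite /mkseq filter_map; congr map.
rewrite -(subnKC ln) iotaD filter_cat add0n.
rewrite (@all_filterP _ _ (iota 0 l) _) ?(@eq_in_filter _ _ pred0).
- by rewrite filter_pred0 cats0.
- by move=> k /=; rewrite mem_iota subnKC// -kl => /andP[+ _]; lia.
- by apply/allP => k /=; rewrite mem_iota add0n subnKC// -kl.
Qed.

Lemma nth_partition_shape k :
  nth 0 (partition_shape n (blocks n a)) k = block_size a k n.
Proof.
have [l -> [_ kl]] := partition_shapeE.
have [lt|] := ltnP k l; first by rewrite nth_mkseq.
move=> le; rewrite nth_default ?size_mkseq//.
by apply/esym/eqP; rewrite -leqn0 leqNgt -kl -leqNgt.
Qed.

Lemma size_partition_shape k :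
  (k < size (partition_shape n (blocks n a))) = (0 < block_size a k n).
Proof. by have [l -> [_ kl]] := partition_shapeE; rewrite size_mkseq. Qed.

Lemma size_partition_shape_le : size (partition_shape n (blocks n a)) <= n.
Proof. by have [l -> []] := partition_shapeE; rewrite size_mkseq. Qed.

End shape.

Local Open Scope ring_scope.

(** * Convergence of averages *)

Section frequencies.
Variable R : realType.
Implicit Types (S : nat -> nat) (u : nat -> R).

(** Controls the frequency between two consecutive fourth powers. *)
Lemma frequency_variation S p n : (S p <= p)%N -> (S p <= S n)%N ->
  (S n <= S p + (n - p))%N -> (0 < p)%N -> (p <= n)%N ->
  `|(S n)%:R / n%:R - (S p)%:R / p%:R| <= (n - p)%:R / p%:R :> R.
Proof.
move=> Spp Spn Sn p0 pn.
have p0' : 0 < p%:R :> R by rewrite ltr0n.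
have n0' : 0 < n%:R :> R by rewrite ltr0n (leq_trans p0).
have E : (S n)%:R / n%:R - (S p)%:R / p%:R =
   ((S n)%:R * p%:R - (S p)%:R * n%:R) / (n%:R * p%:R) :> R.
  by field; rewrite !gt_eqF.
rewrite E normrM normfV (gtr0_norm (mulr_gt0 n0' p0')).
rewrite ler_pdivrMr ?mulr_gt0// -mulrA [n%:R * _]mulrC mulKf ?gt_eqF//.
have {}Spp : (S p)%:R <= p%:R :> R by rewrite ler_nat.
have {}Spn : (S p)%:R <= (S n)%:R :> R by rewrite ler_nat.
have {}Sn : (S n)%:R <= (S p)%:R + (n%:R - p%:R) :> R.
  by rewrite -natrB// -natrD ler_nat.
have Sp0 : 0 <= (S p)%:R :> R by rewrite ler0n.
have pn' : p%:R <= n%:R :> R by rewrite ler_nat.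
rewrite natrB// ler_norml; apply/andP; split; nra.
Qed.

Lemma pow4_bracket n : (0 < n)%N ->
  exists2 k, (k.+1 ^ 4 <= n)%N & (n < k.+2 ^ 4)%N.
Proof.
move=> n0; have ex : exists k, (n < k.+2 ^ 4)%N.
  exists n; apply: (@leq_trans (n.+2 ^ 1)); first lia.
  by rewrite leq_exp2l.
case: (ex_minnP ex) => k nk mink; exists k => //.
case: k nk mink => // k nk mink; rewrite leqNgt; apply/negP => /mink; lia.
Qed.

Lemma cvg_frequency_pow4 S (l : R) :
  (forall n, (S n <= n)%N) -> (forall p n, (p <= n)%N ->
    (S p <= S n)%N /\ (S n <= S p + (n - p))%N) ->
  (fun k => (S (k.+1 ^ 4)%N)%:R / (k.+1 ^ 4)%:R) @ \oo --> l ->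
  (fun n => (S n)%:R / n%:R) @ \oo --> l.
Proof.
move=> Sn Smono cvgS; apply/cvgrPdist_le => e e0.
have e2 : 0 < e / 2 by rewrite divr_gt0.
move/cvgrPdist_le : cvgS => /(_ _ e2)[K1 _ HK1].
(* Since (x+1)^4 - x^4 <= 15 x^3 for x >= 1, the frequency moves by at most 15/(k+1) between (k+1)^4
   and (k+2)^4. *)
have [K2 HK2] : exists K2 : nat, 15 / (e / 2) <= K2%:R.
  by exists (Num.truncn (15 / (e / 2))).+1; apply/ltW/truncnS_gt.
pose K := maxn K1 K2.
exists (K.+1 ^ 4)%N => // n /= Kn.
have n0 : (0 < n)%N by apply: leq_trans Kn; rewrite expn_gt0.
have [k kn nk] := pow4_bracket n0.
have Kk : (K <= k)%N.
  have : (K.+1 ^ 4 < k.+2 ^ 4)%N by apply: leq_ltn_trans nk.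
  by rewrite ltn_exp2r// ltnS.
have := HK1 k (leq_trans (leq_maxl _ _) Kk).
set L := (S (k.+1 ^ 4)%N)%:R / _ => H1.
have [S1 S2] := Smono _ _ kn.
have k0 : (0 < k.+1 ^ 4)%N by rewrite expn_gt0.
have H2 := frequency_variation (Sn _) S1 S2 k0 kn.
have H3 : (n - k.+1 ^ 4)%:R / (k.+1 ^ 4)%:R <= e / 2.
  rewrite ler_pdivrMr ?ltr0n//.
  have kK : 15 / (e / 2) <= k.+1%:R.
    apply: le_trans HK2 _; rewrite ler_nat; apply: leq_trans (leqnSn k).
    by apply: leq_trans Kk; rewrite leq_maxr.
  rewrite ler_pdivrMr// in kK.
  apply: (@le_trans _ _ (15 * (k.+1 ^ 3)%:R)).
    rewrite -natrM ler_nat.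
    apply: (@leq_trans (k.+2 ^ 4 - k.+1 ^ 4)); first by apply: leq_sub2r; exact: ltnW.
    rewrite leq_subLR; move: (k) => x; nia.
  rewrite [(k.+1 ^ 4)%N]expnS natrM mulrA [e / 2 * _]mulrC.
  by rewrite ler_wpM2r.
rewrite -[l](subrK L) -addrA; apply: le_trans (ler_normD _ _) _.
rewrite [e]splitr; apply: lerD; first exact: H1.
by rewrite distrC (le_trans H2).
Qed.

Lemma sum_inv_sqr_le n :
  \sum_(k < n) (k.+1%:R ^+ 2)^-1 <= 2 :> R.
Proof.
case: n => [|n]; first by rewrite big_ord0.
(* The sharper bound is inductive, because 1/(n+2)^2 <= 1/(n+1) - 1/(n+2). *)
suff : \sum_(k < n.+1) (k.+1%:R ^+ 2)^-1 <= 2 - n.+1%:R^-1 :> R.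
  by move=> /le_trans; apply; rewrite gerBl invr_ge0.
elim: n => [|n IH]; first by rewrite big_ord1 expr1n invr1; lra.
rewrite big_ord_recr /=; apply: le_trans (lerD IH (lexx _)) _.
have n0 : 0 <= n%:R :> R by [].
rewrite -[n.+2]addn1 -[n.+1]addn1 !natrD; move: (n%:R) n0 => x x0.
have -> : 2 - (x + 1)^-1 + ((x + 1 + 1) ^+ 2)^-1 =
    2 - (x + 1 + 1)^-1 - ((x + 1 + 1) ^+ 2 * (x + 1))^-1.
  by field; apply/andP; split; rewrite gt_eqF//; lra.
rewrite gerBl invr_ge0 mulr_ge0 ?sqr_ge0//; lra.
Qed.

(* AM-GM turns the weighted square-summability into absolute summability. *)
Lemma cvg_sqr_increments (u : nat -> R) :
  (\sum_(0 <= k <oo) (k.+1%:R ^+ 2 * (u k.+1 - u k) ^+ 2)%:E < +oo)%E ->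
  cvgn u.
Proof.
move=> sumoo; set s := (\sum_(0 <= k <oo) _)%E in sumoo.
have g0 k : (0 <= (k.+1%:R ^+ 2 * (u k.+1 - u k) ^+ 2)%:E)%E.
  by rewrite lee_fin mulr_ge0 ?sqr_ge0.
have s0 : (0 <= s)%E by exact: nneseries_ge0.
have sfin : s \is a fin_num by rewrite ge0_fin_numE.
suff : cvgn (series (telescope u)).
  move=> cv; rewrite (_ : u = series (telescope u) \+ cst (u 0%N)); last first.
    by apply/funext => n; rewrite [LHS]eq_sum_telescope addrC.
  by apply: is_cvgD => //; exact: is_cvg_cst.
apply: normed_cvg; apply: nondecreasing_is_cvgn.
  apply/nondecreasing_seqP => n.
  by rewrite /normed_series_of /series /= big_nat_recr//= lerDl.
exists (2 + fine s) => _ [n _ <-].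
rewrite /normed_series_of /series /= big_mkord.
have Hn : \sum_(k < n) (k.+1%:R ^+ 2 * (u k.+1 - u k) ^+ 2) <= fine s.
  rewrite -lee_fin fineK// -sumEFin -(big_mkord xpredT
    (fun k => (k.+1%:R ^+ 2 * (u k.+1 - u k) ^+ 2)%:E)).
  exact: nneseries_lim_ge.
apply: le_trans (lerD (sum_inv_sqr_le n) Hn).
rewrite -big_split /=; apply: ler_sum => k _.
rewrite -[telescope u k]/(u k.+1 - u k).
have k0 : 0 < k.+1%:R :> R by [].
move: (k.+1%:R) (u k.+1 - u k) k0 => x y x0.
rewrite -[y ^+ 2]real_normK ?num_real// -exprVn -exprMn.
have : `|y| = x^-1 * (x * `|y|) by rewrite mulKf ?gt_eqF.
by move: (x^-1) (x * `|y|) => p q ->; nra.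
Qed.

(** Adding c hits and m trials moves the quotient by at most (c + m)/n. In use, c is the number of
    hits among the first m elements. *)
Lemma cvg_frequency_shift (S : nat -> nat) (c m : nat) (l : R) :
  (forall n, (S n <= n)%N) ->
  (fun n => (S n)%:R / n%:R) @ \oo --> l ->
  (fun n => (c + S n)%N%:R / (m + n)%N%:R) @ \oo --> l.
Proof.
move=> Sn /cvgrPdist_le Sl; apply/cvgrPdist_le => e e0.
have e2 : 0 < e / 2 by rewrite divr_gt0.
have [K1 _ HK1] := Sl _ e2.
have [K2 HK2] : exists K2 : nat, (c + m)%:R / (e / 2) <= K2%:R.
  by exists (Num.truncn ((c + m)%:R / (e / 2))).+1; apply/ltW/truncnS_gt.
exists (maxn K1 K2).+1 => // n /= Kn.
have {}HK1 := HK1 n (leq_trans (leq_maxl K1 K2) (ltnW Kn)).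
have K2n : (K2 <= n)%N by apply: leq_trans (ltnW Kn); rewrite leq_maxr.
have n0 : 0 < n%:R :> R by rewrite ltr0n; apply: leq_trans Kn.
have m0 : 0 <= m%:R :> R by [].
have c0 : 0 <= c%:R :> R by [].
have S0 : 0 <= (S n)%:R :> R by [].
have {}Sn : (S n)%:R <= n%:R :> R by rewrite ler_nat.
have {}HK2 : (c%:R + m%:R) <= e / 2 * n%:R.
  rewrite -natrD mulrC -ler_pdivrMr//; apply: le_trans HK2 _.
  by rewrite ler_nat.
rewrite -[l](subrK ((S n)%:R / n%:R)) -addrA; apply: le_trans (ler_normD _ _) _.
rewrite [e]splitr; apply: lerD; first exact: HK1.
rewrite !natrD.
move: (S n)%:R n%:R m%:R c%:R (e / 2) n0 m0 c0 S0 Sn HK2 {HK1}.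
move=> s x y z f x0 y0 z0 s0 sx zf.
have -> : s / x - (z + s) / (y + x) = (s * y - z * x) / (x * (y + x)).
  by field; apply/andP; split; rewrite gt_eqF//; lra.
have xy0 : 0 < x * (y + x) by rewrite mulr_gt0//; lra.
rewrite ler_norml ler_pdivrMr// ler_pdivlMr//.
have H1 : z * x + y * x <= f * x * x by rewrite -mulrDl ler_wpM2r// ltW.
have f0 : 0 <= f by rewrite -(pmulr_lge0 _ x0); lra.
have H2 : 0 <= f * x * y by rewrite !mulr_ge0// ltW.
have H3 : s * y <= x * y by rewrite ler_wpM2r.
have H4 : 0 <= s * y by rewrite mulr_ge0.
have H5 : 0 <= z * x by rewrite mulr_ge0// ltW.
have H6 : f * (x * (y + x)) = f * x * y + f * x * x by ring.
apply/andP; split; [rewrite mulNr|]; rewrite H6; lra.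
Qed.

Lemma eq_limn_esup (u v : (\bar R)^nat) N :
  (forall n, (N <= n)%N -> u n = v n) -> limn_esup u = limn_esup v.
Proof.
move=> uv; rewrite !limn_esup_lim; apply: cvg_lim => //.
have cv : esups v @ \oo --> limn (esups v) by exact: is_cvg_esups.
apply: cvg_trans cv; apply: near_eq_cvg; exists N => // n /= Nn.
congr ereal_sup; apply/seteqP; split => _ [k /= nk <-]; exists k => //;
  by rewrite uv// (leq_trans Nn).
Qed.

End frequencies.

(** * Integrals of sums of indicators and of bounded functions *)

Section probability_integrals.
Context (d : measure_display) (T : measurableType d) (R : realType).
Variable P : probability T R.

Lemma integral_sqr_sum_indic n (c : nat -> R) (A : nat -> set T) (F : set T) :
  measurable F -> (forall t, measurable (A t)) ->
  (\int[P]_(w in F) ((\sum_(t < n) c t * \1_(A t) w) ^+ 2)%:E =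
   (\sum_(s < n) \sum_(t < n)
      c s * c t * fine (P (F `&` A s `&` A t)))%:E)%E.
Proof.
move=> mF mA.
have mAA s t : measurable (A s `&` A t) by exact: measurableI.
have intA s t : P.-integrable F
    (fun w => (c s * c t)%:E * (\1_(A s `&` A t) w)%:E)%E.
  apply: integrableZl => //; apply: integrableS (integrable_indic _ _) => //.
transitivity (\int[P]_(w in F) (\sum_(s < n) (\sum_(t < n)
    ((c s * c t)%:E * (\1_(A s `&` A t) w)%:E))))%E.
  apply: eq_integral => w _; rewrite expr2 mulr_suml -sumEFin.
  apply: eq_bigr => s _; rewrite mulr_sumr -sumEFin; apply: eq_bigr => t _.
  by rewrite -EFinM indicI/=; congr EFin; ring.
rewrite integral_sum//; last by move=> s; exact: integrable_sum.
rewrite -sumEFin; apply: eq_bigr => s _.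
rewrite integral_sum// -sumEFin; apply: eq_bigr => t _.
rewrite integralZl//; last by apply: integrableS (integrable_indic _ _) => //.
rewrite integral_indic// [RHS]EFinM fineK ?fin_num_measure//; last first.
  by apply: measurableI => //; exact: measurableI.
by rewrite setIC setIA.
Qed.
Lemma bounded_integrable (D : set T) (f : T -> R) (c : R) : measurable D ->
  measurable_fun setT f -> (forall w, `|f w| <= c) ->
  P.-integrable D (EFin \o f).
Proof.
move=> mD mf fc; apply: measurable_bounded_integrable => //.
- by rewrite ltey_eq fin_num_measure.
- exact: measurable_funTS.
- exists c; split; first exact: num_real.
  by move=> x cx w _; exact: le_trans (fc w) (ltW cx).
Qed.

Lemma integral_complement (D : set T) (x : nat -> T -> R) r : measurable D ->
  (forall k, measurable_fun setT (x k)) -> (forall k w, `|x k w| <= 1) ->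
  (\int[P]_(w in D) (1 - \sum_(k < r) x k w)%:E =
   P D - \sum_(k < r) \int[P]_(w in D) (x k w)%:E)%E.
Proof.
move=> mD mx x1.
have ix k : P.-integrable D (fun w => (x k w)%:E).
  exact: (@bounded_integrable _ _ 1).
rewrite -integral_sum// -[P D]mul1e -integral_cst// -integralB//.
- by apply: eq_integral => w _; rewrite EFinB -sumEFin.
- exact: finite_measure_integrable_cst.
- exact: integrable_sum.
Qed.

End probability_integrals.

(** * Quadratic forms in the difference of two means *)

Section contrast.
Variable R : realType.

Lemma sum_ltn_ord n n' : (n <= n')%N -> \sum_(t < n') (t < n)%N%:R = n%:R :> R.
Proof.
move=> nn'; rewrite -natr_sum; congr _%:R.
transitivity (\sum_(t < n) 1)%N; last by rewrite sum1_card card_ord.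
rewrite (big_ord_widen n' (fun=> 1%N))// [RHS]big_mkcond.
by apply: eq_bigr => t _; case: (t < n)%N.
Qed.

(* The contrast between the means of the first n and of the first n' terms. *)
Definition contrast (n n' t : nat) : R := (t < n)%N%:R / n%:R - n'%:R^-1.

Lemma contrastE n n' (x : nat -> nat) : (n <= n')%N ->
  (\sum_(t < n) x t)%N%:R / n%:R - (\sum_(t < n') x t)%N%:R / n'%:R =
  \sum_(t < n') contrast n n' t * (x t)%:R.
Proof.
move=> nn'; rewrite /contrast; under [RHS]eq_bigr do rewrite mulrBl.
rewrite sumrB -mulr_sumr -natr_sum [n'%:R^-1 * _]mulrC; congr (_ - _).
rewrite (big_ord_widen n' x)// big_mkcond/= natr_sum mulr_suml.
by apply: eq_bigr => t _; case: (t < n)%N; rewrite ?mul0r// mul1r mulrC.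
Qed.

Lemma sum_contrast n n' : (0 < n)%N -> (n <= n')%N ->
  \sum_(t < n') contrast n n' t = 0.
Proof.
(* The constant sequence 1 has the same mean over both ranges. *)
move=> n0 nn'; have := @contrastE n n' (fun=> 1%N) nn'.
rewrite !sum1_card !card_ord !divff ?pnatr_eq0 -?lt0n ?(leq_trans n0)// subrr.
by move=> /esym; under eq_bigr do rewrite mulr1.
Qed.

Lemma sum_sqr_contrast n n' : (0 < n)%N -> (n <= n')%N ->
  \sum_(t < n') contrast n n' t ^+ 2 = n%:R^-1 - n'%:R^-1.
Proof.
move=> n0 nn'; have n'0 := leq_trans n0 nn'.
rewrite /contrast.
transitivity (\sum_(t < n') ((t < n)%N%:R *
    (n%:R^-1 ^+ 2 - 2 / (n%:R * n'%:R)) + n'%:R^-1 ^+ 2 : R)).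
  apply: eq_bigr => t _; case: (t < n)%N; rewrite ?mul1r ?mul0r /=; field;
  rewrite !pnatr_eq0 -!lt0n ?n0 ?n'0//.
rewrite big_split/= -mulr_suml sum_ltn_ord// sumr_const card_ord -mulr_natl.
by field; rewrite !pnatr_eq0 -!lt0n n0 n'0.
Qed.

(** The matrix is q times the all-ones matrix plus p - q times the identity. The first part
    contributes nothing, because the contrast coefficients sum to 0. *)
Lemma contrast_quadratic n n' (p q : R) : (0 < n)%N -> (n <= n')%N ->
  \sum_(s < n') \sum_(t < n') contrast n n' s * contrast n n' t *
     (if s == t then p else q) = (p - q) * (n%:R^-1 - n'%:R^-1).
Proof.
move=> n0 nn'; rewrite -sum_sqr_contrast// mulr_sumr.
apply: eq_bigr => s _; set c := contrast n n'.
transitivity (q * c s * (\sum_(t < n') c t) + (p - q) * c s ^+ 2); last first.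
  by rewrite sum_contrast// mulr0 add0r.
rewrite mulr_sumr (bigD1 s)//= [in RHS](bigD1 s)//= eqxx addrAC.
congr (_ + _); first ring.
by apply: eq_bigr => t; rewrite eq_sym => /negPf ->; ring.
Qed.

End contrast.

(** * Boundedness and measurability of the extension probabilities *)

Section extension_prob.
Variables (R : realType) (rho : nat -> nat).

Lemma extension_prob_bound (p : nat -> R) (lambda : seq nat) (j : nat) :
  (forall i, 0 <= p i <= 1) ->
  `|extension_prob rho p lambda j| <= 1 + (size lambda)%:R.
Proof.
move=> p01; have s0 : 0 <= (size lambda)%:R :> R by [].
have pj : `|p j| <= 1 + (size lambda)%:R.
  by have /andP[p0 p1] := p01 j; rewrite ger0_norm//; lra.
have psum k : (k <= size lambda)%N ->
    `|1 - \sum_(i < k) p i| <= 1 + (size lambda)%:R.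
  move=> ks; have q0 : 0 <= \sum_(i < k) p i.
    by apply: sumr_ge0 => i _; have /andP[] := p01 i.
  have q1 : \sum_(i < k) p i <= (size lambda)%:R.
    apply: (@le_trans _ _ (\sum_(i < k) 1)).
      by apply: ler_sum => i _; have /andP[] := p01 i.
    by rewrite sumr_const card_ord ler_nat.
  by rewrite ler_norml; apply/andP; split; lra.
rewrite /extension_prob; case: ifP => // _; case: ifP => // _; case: ifP => // _.
- by apply: psum; exact: leq_pred.
- exact: psum.
- by rewrite normr0 addr_ge0.
Qed.

Lemma measurable_extension_prob (d : measure_display) (T : measurableType d)
    (X : nat -> T -> R) (lambda : seq nat) (j : nat) :
  (forall i, measurable_fun setT (X i)) ->
  measurable_fun setT (fun w => extension_prob rho (X ^~ w) lambda j).
Proof.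
move=> mX; have mS k : measurable_fun setT (fun w => 1 - \sum_(i < k) X i w).
  by apply: measurable_funB => //; apply: measurable_sum.
rewrite /extension_prob; cbv zeta; set l := size lambda.
case: (j < l.-1)%N => //; case: (j == l.-1); last by case: (_ && _).
by case: (_ <= _)%N.
Qed.

End extension_prob.

Lemma sum_eq_ord (R : realType) (v r : nat) :
  \sum_(k < r) (v == k)%:R = (v < r)%N%:R :> R.
Proof.
elim: r => [|r IH]; first by rewrite big_ord0.
rewrite big_ord_recr/= IH ltnS [in RHS]leq_eqVlt.
by have [->|_] := eqVneq v r; rewrite ?ltnn ?add0r ?addr0 /= ?add0r.
Qed.

(** * Invariance under adjacent transpositions *)

Definition depends_on_first (n : nat) (H : set (nat -> nat)) : Prop :=
  forall u u', (forall t, (t < n)%N -> u t = u' t) -> H u -> H u'.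

(** Words of length n over n letters form a finite type that covers all possible initial labels;
    beyond n the value 0 is only a default. *)
Definition word_fun (n : nat) (s : {ffun 'I_n -> 'I_n}) (t : nat) : nat :=
  if insub t is Some i then s i : nat else 0%N.

Section allocation.
Context (d : measure_display) (T : measurableType d) (R : realType).
Variables (P : probability T R) (rho : nat -> nat) (a : T -> nat -> nat).

Definition cylinder (n : nat) (u : nat -> nat) : set T :=
  [set w | forall t, (t < n)%N -> a w t = u t].

Definition full (j n : nat) : set T :=
  [set w | (rho j <= block_size (a w) j n)%N].

(** As [swap i] is an involution, the one-sided implication already means invariance. These events
    are stable under intersection, which the uniqueness theorem for measures requires. *)
Definition swap_invariant_events (i : nat) : set (set T) :=
  [set B | exists n H, [/\ depends_on_first n H,
    forall u, H u -> H (u \o swap i) & B = a @^-1` H]].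

Hypothesis a_rg : forall w, restricted_growth (a w).
Hypothesis a_measurable : forall i k, measurable [set w | a w i = k].
(** The only form in which exchangeability enters this section. *)
Hypothesis cylinder_swap : forall n i j u, (i.+1 < n)%N ->
  (rho j <= block_size u j i)%N -> u i = j \/ u i.+1 = j ->
  P (cylinder n u) = P (cylinder n (u \o swap i)).

Lemma cylinder_measurable n u : measurable (cylinder n u).
Proof.
have -> : cylinder n u = \bigcap_(t in `I_n) [set w | a w t = u t] by [].
by apply: bigcap_measurableType => t _; exact: a_measurable.
Qed.

Lemma event_bigcup n H : depends_on_first n H ->
  a @^-1` H = \bigcup_(s in [set: {ffun 'I_n -> 'I_n}])
    (cylinder n (word_fun s) `&` [set _ | H (word_fun s)]).
Proof.
move=> Hn; apply/seteqP; split => w /=.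
  move=> Hw; have aw (t : 'I_n) : (a w t < n)%N.
    exact: leq_ltn_trans (restricted_growth_le (@a_rg w) t) (ltn_ord t).
  pose s := [ffun t : 'I_n => Ordinal (aw t)].
  have sw t : (t < n)%N -> a w t = word_fun s t.
    by move=> tn; rewrite /word_fun insubT ffunE.
  by exists s => //; split => //; exact: Hn Hw.
by move=> [s _ [sw]]; apply: Hn => t tn; rewrite sw.
Qed.

Lemma trivIset_words n (F : {ffun 'I_n -> 'I_n} -> set T) :
  trivIset setT (fun s => cylinder n (word_fun s) `&` F s).
Proof.
move=> s s' _ _ [w [[sw _] [s'w _]]]; apply/ffunP => t; apply: val_inj.
have E (r : {ffun 'I_n -> 'I_n}) : word_fun r t = r t.
  by rewrite /word_fun valK.
by rewrite /= -!E -sw// -s'w.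
Qed.

Lemma event_measurable n H : depends_on_first n H -> measurable (a @^-1` H).
Proof.
move=> /event_bigcup ->; apply: fin_bigcup_measurable => // s _.
have [Hs|Hs] := pselect (H (word_fun s)).
  by rewrite (propT Hs) setIT; exact: cylinder_measurable.
by rewrite (propF Hs) setI0.
Qed.

Lemma probability_event n H : depends_on_first n H ->
  P (a @^-1` H) = (\sum_(s \in [set: {ffun 'I_n -> 'I_n}])
    P (cylinder n (word_fun s) `&` [set _ | H (word_fun s)]))%E.
Proof.
move=> Hn; rewrite {1}(event_bigcup Hn) measure_fin_bigcup//; first exact: finite_finset.
  exact: (@trivIset_words n (fun s => [set _ | H (word_fun s)])).
move=> s _; have [Hs|Hs] := pselect (H (word_fun s)).
  by rewrite (propT Hs) setIT; exact: cylinder_measurable.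
by rewrite (propF Hs) setI0.
Qed.

Lemma eq_cylinder n u u' :
  (forall t, (t < n)%N -> u t = u' t) -> cylinder n u = cylinder n u'.
Proof.
by move=> uu'; apply/seteqP; split => w uw t tn; rewrite uw// uu'.
Qed.

Lemma depends_on_first_full j m n i : (m <= n)%N -> (i < n)%N ->
  depends_on_first n [set u | (rho j <= block_size u j m)%N /\ u i = j].
Proof.
move=> mn ni u u' uu' [fu ui]; split; last by rewrite -uu'.
by rewrite -(@eq_block_size u)// => t tm; rewrite uu'// (leq_trans tm).
Qed.

Lemma depends_on_firstI n H H' :
  depends_on_first n H -> depends_on_first n H' -> depends_on_first n (H `&` H').
Proof. by move=> Hn H'n u u' uu' [/(Hn _ _ uu') ? /(H'n _ _ uu') ?]. Qed.

Lemma depends_on_first_le m n H : (m <= n)%N ->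
  depends_on_first m H -> depends_on_first n H.
Proof.
by move=> mn Hm u u' uu'; apply: Hm => t tm; apply: uu'; exact: leq_trans mn.
Qed.

(** Both events are finite disjoint unions of cylinders. Composing words with [swap i] matches the
    cylinders of one with those of the other, and [cylinder_swap] equates their probabilities. *)
Lemma probability_swap n j m i H : (m <= i)%N -> depends_on_first n H ->
  (forall u, H u -> H (u \o swap i)) ->
  P (full j m `&` [set w | a w i = j] `&` a @^-1` H) =
  P (full j m `&` [set w | a w i.+1 = j] `&` a @^-1` H).
Proof.
move=> mi Hn' Hi; wlog iN : n Hn' / (i.+1 < n)%N.
  move=> /(_ (maxn n i.+2)); apply; last by rewrite leq_maxr.
  by apply: depends_on_first_le Hn'; rewrite leq_maxl.
pose K t := [set u : nat -> nat | (rho j <= block_size u j m)%N /\ u t = j] `&` H.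
have Kn t : (t < n)%N -> depends_on_first n (K t).
  move=> tn; apply: depends_on_firstI => //; apply: depends_on_first_full => //.
  by rewrite ltnW// (leq_ltn_trans mi)// ltnW.
rewrite -[LHS]/(P (a @^-1` K i)) -[RHS]/(P (a @^-1` K i.+1)).
rewrite (probability_event (Kn _ iN)) (probability_event (Kn _ (ltnW iN))).
pose sw (s : {ffun 'I_n -> 'I_n}) :=
  [ffun t : 'I_n => s (Ordinal (etrans (swap_lt t iN) (ltn_ord t)))].
have swK : involutive sw.
  move=> s; apply/ffunP => t; rewrite !ffunE; congr (s _); apply: val_inj.
  exact: swapK.
have swE s t : (t < n)%N -> word_fun (sw s) t = (word_fun s \o swap i) t.
  move=> tn; rewrite /= /word_fun insubT ffunE.
  have H2 : (swap i t < n)%N by rewrite swap_lt.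
  by rewrite insubT; congr (nat_of_ord (s _)); apply: val_inj.
rewrite (@reindex_fsbig _ _ _ _ _ sw setT setT); last first.
  by split => // [s s' _ _ /(can_inj swK)//|s _]; exists (sw s).
apply: eq_fsbigr => s _; set u := word_fun s.
rewrite (eq_cylinder (swE s)) -/u.
have KK : K i.+1 u <-> K i (u \o swap i).
  rewrite /K /= swapL block_size_swap_le//; split => -[? Hu]; split => //.
    exact: Hi.
  have -> : u = (u \o swap i) \o swap i by apply/funext => t /=; rewrite swapK.
  exact: Hi.
have [k|k] := pselect (K i.+1 u).
  have k' := KK.1 k; have kd := Kn i (ltnW iN) _ _ (fun t tn => esym (swE s t tn)) k'.
  rewrite (propT k) (propT kd) !setIT; apply/esym.
  move: k => [[fu ui] _]; apply: (@cylinder_swap _ _ j) => //; last by right.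
  by apply: leq_trans fu _; exact: leq_block_size.
have kd : ~ K i (word_fun (sw s)).
  by move=> kd; apply: k; apply/KK; apply: (Kn i (ltnW iN)) kd => t tn; exact: swE.
by rewrite (propF k) (propF kd) !setI0.
Qed.

Lemma full_measurable j n : measurable (full j n).
Proof.
rewrite -[full j n]/(a @^-1` [set u | (rho j <= block_size u j n)%N]).
apply: (@event_measurable n) => u u' uu' /=.
by rewrite (@eq_block_size u u').
Qed.

Lemma sigma_swap_invariant_measurable i B :
  <<s swap_invariant_events i >> B -> measurable B.
Proof.
apply: smallest_sub; first exact: sigma_algebra_measurable.
by move=> _ [n [H [Hn _ ->]]]; exact: event_measurable Hn.
Qed.

(** As functions of B both sides are finite measures, and by [probability_swap] they agree on a
    generating family stable under intersection. *)
Lemma sigma_swap j m i B : (m <= i)%N -> <<s swap_invariant_events i >> B ->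
  P (full j m `&` [set w | a w i = j] `&` B) =
  P (full j m `&` [set w | a w i.+1 = j] `&` B).
Proof.
move=> mi.
have mF t : measurable (full j m `&` [set w | a w t = j]).
  by apply: measurableI; [exact: full_measurable|exact: a_measurable].
have -> : P (full j m `&` [set w | a w i = j] `&` B) = mrestr P (mF i) B.
  by rewrite /mrestr setIC.
have -> : P (full j m `&` [set w | a w i.+1 = j] `&` B) = mrestr P (mF i.+1) B.
  by rewrite /mrestr setIC.
apply: (g_sigma_algebra_measure_unique (swap_invariant_events i) _ (fun=> setT)).
- by move=> _ [n [H [Hn _ ->]]]; exact: event_measurable Hn.
- by move=> _; exists 0%N, setT; split.
- by rewrite bigcup_const.
- move=> _ _ [n [H [Hn Hi ->]]] [n' [H' [Hn' Hi' ->]]].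
  exists (maxn n n'), (H `&` H'); split => //.
    apply: depends_on_firstI.
      by apply: depends_on_first_le Hn; rewrite leq_maxl.
    by apply: depends_on_first_le Hn'; rewrite leq_maxr.
  by move=> u [/Hi ? /Hi' ?].
- move=> _ [n [H [Hn Hi ->]]] /=; rewrite /mrestr ![a @^-1` H `&` _]setIC.
  exact: probability_swap Hn Hi.
- by move=> _; rewrite /mrestr; apply: fin_num_fun_lty; exact: fin_num_measure.
Qed.

(** * Existence of the limit frequencies *)

Definition joins (j t : nat) : set T := [set w | a w t = j].

Definition hits (j m : nat) (w : T) (n : nat) : nat :=
  block_size (fun t => a w (m + t)%N) j n.

Lemma joins_invariant i t j : (t < i)%N \/ (i.+1 < t)%N ->
  <<s swap_invariant_events i >> (joins j t).
Proof.
move=> it; apply: sub_sigma_algebra; exists t.+1, [set u | u t = j]; split => //.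
- by move=> u u' uu' /=; rewrite uu'.
- by move=> u /=; case: it => it; [rewrite swap_id|rewrite swap_gt].
Qed.

(** Brings i down to l by the adjacent transpositions at i-1, ..., l, each of which leaves B
    invariant. *)
Lemma sigma_joins j m l i B : (m <= l)%N -> (l <= i)%N ->
  (forall t, (l <= t < i)%N -> <<s swap_invariant_events t >> B) ->
  P (full j m `&` joins j i `&` B) = P (full j m `&` joins j l `&` B).
Proof.
move=> ml /subnKC <-; elim: (i - l)%N => [|p IH]; first by rewrite addn0.
move=> HB; rewrite -{}IH; last first.
  by move=> t /andP[lt tp]; apply: HB; rewrite lt addnS ltnW.
rewrite addnS; apply/esym/sigma_swap; first by rewrite (leq_trans ml)// leq_addr.
by apply: HB; rewrite leq_addr addnS leqnn.
Qed.

(** First s is brought down to m, by transpositions that do not touch t; then t is brought down to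
    m+1, by transpositions that do not touch m. *)
Lemma probability_joins2 j m s t : (m <= s)%N -> (s < t)%N ->
  P (full j m `&` joins j s `&` joins j t) =
  P (full j m `&` joins j m `&` joins j m.+1).
Proof.
move=> ms st; rewrite (@sigma_joins _ _ m)//; last first.
  by move=> i /andP[_ si]; apply: joins_invariant; right; lia.
rewrite setIAC (@sigma_joins _ _ m.+1)//; first by rewrite setIAC.
  exact: leq_ltn_trans st.
by move=> i /andP[mi _]; apply: joins_invariant; left.
Qed.

Lemma fullI_joins2 j m (s t : nat) :
  fine (P (full j m `&` joins j (m + s) `&` joins j (m + t))) =
  if s == t then fine (P (full j m `&` joins j m))
  else fine (P (full j m `&` joins j m `&` joins j m.+1)).
Proof.
have [->|] := eqVneq s t.
  rewrite -setIA setIid -[X in P X]setIT (@sigma_joins _ _ m) ?leq_addr ?setIT//.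
  by move=> i _; by apply: sub_sigma_algebra; exists 0%N, setT.
rewrite neq_ltn => /orP[] st; congr fine.
  by rewrite probability_joins2 ?leq_addr// ltn_add2l.
by rewrite setIAC probability_joins2 ?leq_addr// ltn_add2l.
Qed.

Lemma joins_measurable j t : measurable (joins j t).
Proof. exact: a_measurable. Qed.

Lemma indic_joins j t w : \1_(joins j t) w = (a w t == j)%:R :> R.
Proof.
by rewrite indicE; congr (_ %:R); congr nat_of_bool; apply/idP/eqP; rewrite inE.
Qed.

Lemma hits_measurable j m n : measurable_fun setT (fun w => (hits j m w n)%:R : R).
Proof.
rewrite /hits /block_size; under eq_fun do rewrite natr_sum.
apply: measurable_sum => t.
suff -> : (fun w => (a w (m + t)%N == j)%:R) = \1_(joins j (m + t)) :> (T -> R).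
  by apply: measurable_indic; exact: joins_measurable.
by apply/funext => w; rewrite indic_joins.
Qed.

(** By [fullI_joins2] the second moments take one value p on the diagonal and one value q off it, so
    the integral is (p - q)(1/n - 1/n'), where p <= 1 and q >= 0. *)
Lemma integral_sqr_increment j m n n' : (0 < n)%N -> (n <= n')%N ->
  (\int[P]_(w in full j m)
    (((hits j m w n')%:R / n'%:R - (hits j m w n)%:R / n%:R) ^+ 2)%:E <=
   (n%:R^-1 : R)%:E)%E.
Proof.
move=> n0 nn'.
under eq_integral => w _.
  rewrite -sqrrN opprB /hits /block_size.
  rewrite (@contrastE R n n' (fun t => (a w (m + t)%N == j) : nat))//.
  under eq_bigr do rewrite -indic_joins.
  over.
rewrite (@integral_sqr_sum_indic _ _ _ P n' (@contrast R n n')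
  (fun t => joins j (m + t)) (full j m)); last 2 first.
  exact: full_measurable.
  by move=> t; exact: joins_measurable.
under eq_bigr do under eq_bigr do rewrite fullI_joins2.
rewrite contrast_quadratic// lee_fin.
have c0 A : 0 <= fine (P A) by rewrite fine_ge0.
have c1 A : measurable A -> fine (P A) <= 1.
  by move=> mA; rewrite -lee_fin fineK ?fin_num_measure// probability_le1.
have := c1 _ (measurableI _ _ (full_measurable j m) (joins_measurable j m)).
have := c0 (full j m `&` joins j m `&` joins j m.+1).
have y0 : 0 <= n'%:R^-1 :> R by rewrite invr_ge0.
have yx : n'%:R^-1 <= n%:R^-1 :> R.
  by rewrite lef_pV2 ?posrE ?ltr0n ?ler_nat// (leq_trans n0).
move: (fine _) (fine _) (_^-1) (_^-1) y0 yx => p q x y y0 yx q0 p1; nra.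
Qed.

(* The sum over k of the expected weighted squared increments along the fourth
   powers is at most the sum of 1/(k+1)^2. *)
Lemma ae_cvg_hits_pow4 j m : {ae P, forall w, full j m w ->
  cvgn (fun k => (hits j m w (k.+1 ^ 4))%:R / (k.+1 ^ 4)%:R : R)}.
Proof.
pose M w n : R := (hits j m w n)%:R / n%:R.
pose g k w : \bar R :=
  (k.+1%:R ^+ 2 * (M w (k.+2 ^ 4)%N - M w (k.+1 ^ 4)%N) ^+ 2)%:E.
have mM n : measurable_fun setT (M ^~ n).
  by apply: measurable_funM => //; exact: hits_measurable.
have mg k : measurable_fun (full j m) (g k).
  apply/measurable_EFinP; apply: measurable_funTS; apply: measurable_funM => //.
  by apply: measurable_funX; apply: measurable_funB; exact: mM.
have g0 k w : full j m w -> (0 <= g k w)%E.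
  by move=> _; rewrite lee_fin mulr_ge0 ?sqr_ge0.
have mF := full_measurable j m.
have mS : measurable_fun (full j m) (fun w => \sum_(0 <= k <oo) g k w)%E.
  by apply: ge0_emeasurable_sum => // k w Fw _; exact: g0.
have intg k : (\int[P]_(w in full j m) g k w <= ((k.+1%:R ^+ 2)^-1)%:E)%E.
  rewrite /g; under eq_integral do rewrite EFinM.
  rewrite ge0_integralZl//; last 2 first.
  - apply/measurable_EFinP; apply: measurable_funTS.
    by apply: measurable_funX; apply: measurable_funB; exact: mM.
  - by move=> w _; rewrite lee_fin sqr_ge0.
  apply: le_trans.
    apply: lee_wpmul2l; first by rewrite lee_fin sqr_ge0.
    by apply: integral_sqr_increment; rewrite ?expn_gt0// leq_exp2r.
  rewrite -EFinM lee_fin natrX.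
  have k0 : k.+1%:R != 0 :> R by rewrite pnatr_eq0.
  move: (k.+1%:R) k0 => x x0; rewrite le_eqVlt; apply/orP; left; apply/eqP.
  by field.
have : P.-integrable (full j m) (fun w => \sum_(0 <= k <oo) g k w)%E.
  apply/integrableP; split => //.
  under eq_integral => w Fw.
    rewrite gee0_abs; last first.
      by apply: nneseries_ge0 => k _ _; apply: g0; rewrite inE in Fw.
    over.
  rewrite integral_nneseries//.
  apply: (@le_lt_trans _ _ 2%:E); last exact: ltry.
  apply: lime_le.
    by apply: is_cvg_nneseries => k _ _; apply: integral_ge0 => w; exact: g0.
  apply: nearW => n.
  apply: (@le_trans _ _ (\sum_(0 <= k < n) ((k.+1%:R ^+ 2)^-1)%:E)%E).
    by apply: lee_sum => k _.
  by rewrite sumEFin lee_fin big_mkord sum_inv_sqr_le.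
move=> /(integrable_ae mF); apply: filterS => w /= fin Fw.
move: (fin Fw).
rewrite ge0_fin_numE; last by apply: nneseries_ge0 => k _ _; apply: g0.
exact: (@cvg_sqr_increments R (fun k => M w (k.+1 ^ 4)%N)).
Qed.

Definition frequency (j n : nat) (w : T) : R :=
  (block_size (a w) j n)%:R / n%:R.

(** The upper limit exists at every point and is measurable; it is the limit wherever the
    frequencies converge. *)
Definition limit_frequency (j : nat) (w : T) : R :=
  fine (limn_esup (fun n => (frequency j n w)%:E)).

Lemma block_size_hits j m w n :
  block_size (a w) j (m + n) = (block_size (a w) j m + hits j m w n)%N.
Proof. by rewrite /hits /block_size big_split_ord. Qed.

Lemma frequency_itv j n w : 0 <= frequency j n w <= 1.
Proof.
rewrite /frequency; apply/andP; split; first by rewrite divr_ge0.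
have [->|n0] := posnP n; first by rewrite invr0 mulr0.
by rewrite ler_pdivrMr ?ltr0n// mul1r ler_nat block_size_le.
Qed.

Lemma limit_frequencyP j w (l : R) :
  frequency j ^~ w @ \oo --> l -> limit_frequency j w = l.
Proof.
move=> fl; have fl' : (fun n => (frequency j n w)%:E) @ \oo --> l%:E.
  by apply: cvg_EFin => //; exact: nearW.
rewrite /limit_frequency is_cvg_limn_esupE; last by apply/cvg_ex; exists l%:E.
by rewrite (cvg_lim _ fl').
Qed.

Lemma cvg_hits j m w : 
  cvgn (fun k => (hits j m w (k.+1 ^ 4))%:R / (k.+1 ^ 4)%:R : R) ->
  (fun n => (hits j m w n)%:R / n%:R) @ \oo --> limit_frequency j w /\
  frequency j ^~ w @ \oo --> limit_frequency j w.
Proof.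
move=> /cvg_ex[/= l hl].
have {}hl : (fun n => (hits j m w n)%:R / n%:R) @ \oo --> (l : R).
  apply: cvg_frequency_pow4 hl => [n|p n /subnKC <-]; first exact: block_size_le.
  split; first by apply: leq_block_size; exact: leq_addr.
  rewrite addKn /hits /block_size big_split_ord/= leq_add2l.
  exact: (@block_size_le (fun t => a w (m + (p + t))%N)).
have fl : frequency j ^~ w @ \oo --> (l : R).
  rewrite -(cvg_shiftn m).
  rewrite (_ : [sequence _]_n = fun n =>
      (block_size (a w) j m + hits j m w n)%N%:R / (m + n)%N%:R).
    by apply: cvg_frequency_shift hl => n; exact: block_size_le.
  by apply/funext => n /=; rewrite /frequency addnC block_size_hits.
by rewrite (limit_frequencyP fl).
Qed.

(** Such a block keeps fewer than [rho j] elements forever, so its frequency tends to 0. *)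
Lemma cvg_frequency_not_full j w : (forall m, ~ full j m w) ->
  frequency j ^~ w @ \oo --> limit_frequency j w.
Proof.
move=> nf.
have f0 : frequency j ^~ w @ \oo --> (0 : R).
  apply/cvgrPdist_le => e e0.
  have [K HK] : exists K : nat, (rho j)%:R / e <= K%:R.
    by exists (Num.truncn ((rho j)%:R / e)).+1; apply/ltW/truncnS_gt.
  exists K.+1 => // n /= Kn; have n0 : 0 < n%:R :> R by rewrite ltr0n (leq_trans _ Kn).
  have /andP[f0 _] := frequency_itv j n w.
  rewrite sub0r normrN ger0_norm// ler_pdivrMr//.
  rewrite ler_pdivrMr// mulrC in HK.
  apply: le_trans (_ : (rho j)%:R <= _).
    by rewrite ler_nat ltnW// ltnNge; apply/negP/nf.
  by apply: le_trans HK _; rewrite ler_wpM2l ?(ltW e0)// ler_nat ltnW.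
by rewrite (limit_frequencyP f0).
Qed.

Lemma ae_cvg_frequency : {ae P, forall w,
  (forall j, frequency j ^~ w @ \oo --> limit_frequency j w) /\
  (forall j m, full j m w ->
     (fun n => (hits j m w n)%:R / n%:R) @ \oo --> limit_frequency j w)}.
Proof.
have : {ae P, forall w, forall j m, full j m w ->
    cvgn (fun k => (hits j m w (k.+1 ^ 4))%:R / (k.+1 ^ 4)%:R : R)}.
  by apply: ae_foralln => j; apply: ae_foralln => m; exact: ae_cvg_hits_pow4.
apply: filterS => w cw; split=> [j|j m /cw/cvg_hits[]//].
have [[m /cw/cvg_hits[]//]|nf] := pselect (exists m, full j m w).
by apply: cvg_frequency_not_full => m fm; apply: nf; exists m.
Qed.

Lemma limit_frequency_itv j w : 0 <= limit_frequency j w <= 1.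
Proof.
rewrite /limit_frequency limn_esup_lim; set u := fun n => _.
have cu : cvgn (esups u) by exact: is_cvg_esups.
have u01 n : (0 <= u n <= 1)%E.
  by rewrite /u !lee_fin; exact: frequency_itv.
have L0 : (0 <= limn (esups u))%E.
  apply: lime_ge => //; apply: nearW => n.
  have /andP[u0 _] := u01 n; apply: le_trans u0 _.
  by apply: ereal_sup_ubound; exists n => /=.
have L1 : (limn (esups u) <= 1)%E.
  apply: lime_le => //; apply: nearW => n.
  by apply: ge_ereal_sup => _ [k _ <-]; have /andP[] := u01 k.
have Lf : limn (esups u) \is a fin_num.
  by rewrite ge0_fin_numE// (le_lt_trans L1)// ltry.
by rewrite -!lee_fin fineK// L0 L1.
Qed.

Lemma sigma_limit_frequency i j (Y : set R) : measurable Y ->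
  <<s swap_invariant_events i >> (limit_frequency j @^-1` Y).
Proof.
move=> mY.
pose Ti := g_sigma_algebraType (swap_invariant_events i).
(* Swapping i and i+1 preserves the counts over the first n elements once n > i+1. The earlier terms
   may fail to be invariant, and replacing them by 0 does not affect the upper limit. *)
pose f n (w : Ti) : \bar R := if (n <= i.+1)%N then 0%E else (frequency j n w)%:E.
have mf n : measurable_fun setT (f n).
  rewrite /f; case: leqP => ni; first exact: measurable_cst.
  move=> _ Z mZ; rewrite setTI; apply: sub_sigma_algebra.
  exists n, [set u | Z ((block_size u j n)%:R / n%:R)%:E]; split => //.
    by move=> u u' uu' /=; rewrite (eq_block_size _ uu').
  by move=> u /=; rewrite block_size_swap.
have E : limit_frequency j = fun w : Ti => fine (limn_esup (f ^~ w)).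
  apply/funext => w; rewrite /limit_frequency; congr fine.
  by apply: (@eq_limn_esup _ _ _ i.+2) => n ni; rewrite /f leqNgt ni.
have : measurable_fun setT (limit_frequency j : Ti -> R).
  rewrite E; apply: measurableT_comp => //.
  exact: measurable_fun_limn_esup.
by move=> /(_ measurableT _ mY); rewrite setTI.
Qed.

Lemma limit_frequency_measurable j : measurable_fun setT (limit_frequency j).
Proof.
move=> _ Y mY; rewrite setTI; apply: (@sigma_swap_invariant_measurable 0).
exact: sigma_limit_frequency.
Qed.

(** * The conditional law of the next element *)

Hypothesis a_admissible : {ae P, forall w, forall n, admissible rho (a w) n}.
Hypothesis rho_gt0 : forall k, (0 < rho k)%N.

Lemma hits_frequencyE j m w n :
  (hits j m w n)%:R / n%:R = \sum_(t < n) n%:R^-1 * \1_(joins j (m + t)) w :> R.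
Proof.
rewrite /hits /block_size natr_sum mulr_suml.
by apply: eq_bigr => t _; rewrite indic_joins mulrC.
Qed.

(* By exchangeability the probability of [joins j i] on an event that the swaps
   beyond [m] preserve does not depend on [i >= m], so it is an average of
   frequencies. *)
Lemma integral_hits_frequency j m n B :
  (forall i, (m <= i)%N -> <<s swap_invariant_events i >> B) ->
  (\int[P]_(w in full j m `&` B) ((hits j m w n.+1)%:R / n.+1%:R)%:E =
   P (full j m `&` joins j m `&` B))%E.
Proof.
move=> HB; have mB := sigma_swap_invariant_measurable (HB m (leqnn m)).
have mD : measurable (full j m `&` B).
  by apply: measurableI => //; exact: full_measurable.
have mJ t : measurable (joins j t) by exact: joins_measurable.
under eq_integral do rewrite hits_frequencyE -sumEFin.
rewrite ge0_integral_sum//; last first.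
  by move=> t; apply/measurable_EFinP/measurable_funM => //; apply: measurable_indic.
transitivity (\sum_(t < n.+1) (n.+1%:R^-1)%:E * P (full j m `&` joins j m `&` B))%E.
  apply: eq_bigr => t _; under eq_integral do rewrite EFinM.
  rewrite ge0_integralZl//; last by apply/measurable_EFinP/measurable_indic.
  rewrite integral_indic// setICA setIA -(@sigma_joins j m m (m + t))//.
    exact: leq_addr.
  by move=> i /andP[mi _]; exact: HB.
rewrite -ge0_sume_distrl// sumEFin sumr_const card_ord -[_ *+ _]mulr_natl mulfV//.
by rewrite mul1e.
Qed.

(** Dominated convergence: the integrals of the averages do not depend on n, so their common value
    is the integral of the limit. Averaging over n+1 terms excludes the empty average, which would
    break the constancy. *)
Lemma integral_limit_frequency j m B :
  (forall i, (m <= i)%N -> <<s swap_invariant_events i >> B) ->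
  (\int[P]_(w in full j m `&` B) (limit_frequency j w)%:E =
   P (full j m `&` joins j m `&` B))%E.
Proof.
move=> HB; have mB := sigma_swap_invariant_measurable (HB m (leqnn m)).
have mD : measurable (full j m `&` B).
  by apply: measurableI => //; exact: full_measurable.
pose f n w := ((hits j m w n.+1)%:R / n.+1%:R : R)%:E.
have [|||||_ _] := @dominated_convergence _ _ _ P _ mD f
    (fun w => (limit_frequency j w)%:E) (cst 1%E).
- move=> n; apply/measurable_EFinP/measurable_funTS/measurable_funM => //.
  exact: hits_measurable.
- by apply/measurable_EFinP/measurable_funTS; exact: limit_frequency_measurable.
- apply: filterS ae_cvg_frequency => w [_ cw] [/cw fw _].
  apply: cvg_EFin; first exact: nearW.
  by move: fw; rewrite -cvg_shiftS.
- exact: finite_measure_integrable_cst.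
- apply: nearW => w n _; rewrite /f abse_EFin lee_fin ger0_norm ?divr_ge0//.
  by rewrite ler_pdivrMr// mul1r ler_nat block_size_le.
rewrite (_ : [sequence _]_n = cst (P (full j m `&` joins j m `&` B))).
  by move=> /(cvg_lim (@ereal_hausdorff R)) <-; rewrite lim_cst.
by apply/funext => n /=; rewrite integral_hits_frequency.
Qed.

(** Almost surely on D the element n joins exactly one block among 0, ..., r, so the indicator of
    joining r is 1 minus those of joining the blocks k < r. *)
Lemma integral_remaining (D : set T) n r : measurable D ->
  (forall k, (k < r)%N ->
    \int[P]_(w in D) (limit_frequency k w)%:E = P (joins k n `&` D))%E ->
  {ae P, forall w, D w -> (a w n <= r)%N} ->
  (\int[P]_(w in D) (1 - \sum_(k < r) limit_frequency k w)%:E =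
   P (joins r n `&` D))%E.
Proof.
move=> mD IX ar.
have mJ k : measurable (joins k n) by exact: joins_measurable.
rewrite integral_complement//; last 2 first.
- exact: limit_frequency_measurable.
- by move=> k w; have /andP[X0 X1] := limit_frequency_itv k w; rewrite ger0_norm.
transitivity (P D - \sum_(k < r) \int[P]_(w in D) (\1_(joins k n) w)%:E)%E.
  congr (_ - _)%E; apply: eq_bigr => k _.
  by rewrite IX// integral_indic.
rewrite -(@integral_complement _ _ _ P D (fun k => \1_(joins k n)) r)//; last first.
  by move=> k w; rewrite indic_joins; case: eqP; rewrite ?normr1 ?normr0.
rewrite -integral_indic//; apply: ae_eq_integral => //.
- apply/measurable_EFinP/measurable_funTS/measurable_funB => //.
  by apply: measurable_sum => k; exact: measurable_indic.
- exact/measurable_EFinP/measurable_indic.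
apply: filterS ar => w arw Dw; congr EFin; rewrite indic_joins.
under eq_bigr do rewrite indic_joins.
rewrite sum_eq_ord; have := arw Dw; rewrite leq_eqVlt => /predU1P[->|lt].
  by rewrite ltnn eqxx subr0.
by rewrite lt (ltn_eqF lt) subrr.
Qed.

Lemma sigma_cylinder i n u : (n <= i)%N ->
  <<s swap_invariant_events i >> (cylinder n u).
Proof.
move=> ni; apply: sub_sigma_algebra.
exists n, [set v | forall t, (t < n)%N -> v t = u t]; split => //.
- by move=> v v' vv' vu t tn; rewrite -vv'// vu.
- by move=> v vu t tn /=; rewrite swap_id ?(leq_trans tn)// vu.
Qed.

Definition extension (n j : nat) (w : T) : R :=
  extension_prob rho (limit_frequency ^~ w) (partition_shape n (blocks n (a w))) j.

(** On a cylinder the shape is constant, so a single case of [extension_prob] applies throughout.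
    Full blocks are handled by [integral_limit_frequency], the one other possible block by
    [integral_remaining], and all further blocks have probability 0. *)
Lemma integral_extension_cylinder n j u B : (0 < n)%N ->
  (forall i, (n <= i)%N -> <<s swap_invariant_events i >> B) ->
  (\int[P]_(w in cylinder n u `&` B) (extension n j w)%:E =
   P (joins j n `&` (cylinder n u `&` B)))%E.
Proof.
move=> n0 HB; set D := cylinder n u `&` B.
have HD i : (n <= i)%N -> <<s swap_invariant_events i >> D.
  move=> ni; apply: (@measurableI _ (g_sigma_algebraType (swap_invariant_events i))).
    exact: sigma_cylinder.
  exact: HB.
have mD : measurable D := sigma_swap_invariant_measurable (HD n (leqnn n)).
have Du w t : D w -> (t < n)%N -> a w t = u t by move=> [+ _]; exact.
pose g w := extension_prob rho (limit_frequency ^~ w)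
  (partition_shape n (blocks n u)) j.
have -> : (\int[P]_(w in D) (extension n j w)%:E = \int[P]_(w in D) (g w)%:E)%E.
  apply: eq_integral => w; rewrite inE => Dw; rewrite /extension /g.
  by rewrite ((eq_blocks n (a w) u).2 (fun t => Du w t Dw)).
have mg : measurable_fun setT g.
  by apply: measurable_extension_prob => i; exact: limit_frequency_measurable.
(* Either D contains an admissible point w0, whose block sizes at n are those of all points of D, or
   D is a null set and both sides vanish. *)
have [[w0 [Dw0 adm0]]|nadm] :=
  pselect (exists w0, D w0 /\ forall n, admissible rho (a w0) n); last first.
  have PD0 : P D = 0%E.
    have [N [mN N0 subN]] := a_admissible.
    apply: (@subset_measure0 _ _ _ P _ N) => // w Dw; apply: subN => /= adm.
    by apply: nadm; exists w.
  rewrite null_set_integral//; last exact/measurable_EFinP/measurable_funTS.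
  apply/esym/(@subset_measure0 _ _ _ P _ D) => //.
    by apply: measurableI => //; exact: joins_measurable.
have bsD w k : D w -> block_size (a w) k n = block_size (a w0) k n.
  by move=> Dw; apply: eq_block_size => t tn; rewrite !Du.
have IX k : (rho k <= block_size (a w0) k n)%N ->
    (\int[P]_(w in D) (limit_frequency k w)%:E = P (joins k n `&` D))%E.
  move=> fk; have FD : full k n `&` D = D.
    by apply: setIidr => w Dw; rewrite /full /= bsD.
  by rewrite -{1}FD integral_limit_frequency// setIAC FD setIC.
rewrite /g -((eq_blocks n (a w0) u).2 (fun t => Du w0 t Dw0)).
rewrite /extension_prob; cbv zeta.
set lambda := partition_shape _ _; set l := size lambda.
have sizeE k : (k < l)%N = (0 < block_size (a w0) k n)%N.
  by rewrite /l /lambda size_partition_shape.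
have nthE k : nth 0%N lambda k = block_size (a w0) k n.
  by rewrite /lambda nth_partition_shape.
have l0 : (0 < l)%N.
  rewrite sizeE; apply: leq_trans (leq_block_size _ _ n0).
  rewrite block_sizeS; have := restricted_growth_le (@a_rg w0) 0.
  by rewrite leqn0 => /eqP ->; rewrite addn1.
(* The last block l-1 has an element, and admissibility at that element makes every earlier block
   full. *)
have fulll k : (k < l.-1)%N -> (rho k <= block_size (a w0) k n)%N.
  move=> kl; have : (l.-1 < l)%N by rewrite prednK.
  rewrite sizeE => /block_size_gt0[t tn at']; move: kl; rewrite -at' => kl.
  exact: leq_trans (adm0 n t tn k kl) (leq_block_size _ _ (ltnW tn)).
have joins_le r : (block_size (a w0) r n < rho r)%N ->
    {ae P, forall w, D w -> (a w n <= r)%N}.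
  move=> nfull; apply: filterS a_admissible => w adm Dw.
  rewrite leqNgt; apply/negP => lt.
  by have := adm n.+1 n (ltnSn n) r lt; rewrite bsD// leqNgt nfull.
(* Block l is still empty, hence not full as [rho l] is positive; therefore n cannot go beyond block
   l. *)
have bsl : (block_size (a w0) l n < rho l)%N.
  by apply: leq_trans (rho_gt0 l); rewrite ltnS leqNgt -sizeE ltnn.
have P0 r : {ae P, forall w, D w -> (a w n <= r)%N} -> (r < j)%N ->
    P (joins j n `&` D) = 0%E.
  move=> [N [mN N0 subN]] rj; apply: (@subset_measure0 _ _ _ P _ N) => //.
    by apply: measurableI => //; exact: joins_measurable.
  by move=> w [jw Dw]; apply: subN => /= /(_ Dw); rewrite jw leqNgt rj.
rewrite nthE.
have [jl|lj] := ltnP j l.-1; first by rewrite IX// fulll.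
have [jl|jl] := eqVneq j l.-1.
  have [full'|nfull] := leqP (rho l.-1) (block_size (a w0) l.-1 n).
    by rewrite IX ?jl.
  rewrite jl; apply: integral_remaining => //; last exact: joins_le.
  by move=> k /fulll; exact: IX.
have {jl}lj : (l <= j)%N by rewrite -(prednK l0) ltn_neqAle eq_sym jl.
have al := joins_le _ bsl.
have [full'|nfull] := leqP (rho l.-1) (block_size (a w0) l.-1 n).
  rewrite andbT; have [jl|jl] := eqVneq j l.
    rewrite jl; apply: integral_remaining => // k.
    rewrite -{1}(prednK l0) ltnS leq_eqVlt => /predU1P[->|/fulll]; exact: IX.
  (* Here j > l: no block may be skipped. *)
  by rewrite integral0 (P0 l)// ltn_neqAle eq_sym jl.
by rewrite andbF integral0 (P0 l.-1) ?prednK//; exact: joins_le.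
Qed.

(** Stated for an arbitrary generating family, since it serves both for the swap-invariant events
    and for the sigma-algebra on which the theorem conditions. *)
Lemma sigma_extension n j (G : set (set T)) :
  (forall i (Y : set R), measurable Y -> <<s G >> (limit_frequency i @^-1` Y)) ->
  (forall u, <<s G >> (cylinder n u)) ->
  forall Y : set R, measurable Y -> <<s G >> (extension n j @^-1` Y).
Proof.
move=> GX Gu Y mY; pose TG := g_sigma_algebraType G.
pose g (s : {ffun 'I_n -> 'I_n}) (w : TG) :=
  extension_prob rho (limit_frequency ^~ w) (partition_shape n (blocks n (word_fun s))) j.
have mg (s : {ffun 'I_n -> 'I_n}) : measurable_fun setT (g s).
  apply: measurable_extension_prob => i _ Z mZ; rewrite setTI; exact: GX.
have -> : extension n j @^-1` Y = \bigcup_(s in [set: {ffun 'I_n -> 'I_n}])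
    (cylinder n (word_fun s) `&` g s @^-1` Y).
  have E w s : cylinder n (word_fun s) w -> extension n j w = g s w.
    by move=> sw; rewrite /extension /g ((eq_blocks n (a w) (word_fun s)).2 sw).
  apply/seteqP; split => [w|w [s _ [sw]]]; last by rewrite /= -(E w s sw).
  have : (a @^-1` setT) w by [].
  rewrite (@event_bigcup n setT)// => -[s _ [sw _]] Yw.
  by exists s => //; split => //=; rewrite -(E w s sw).
apply: (@fin_bigcup_measurable _ TG) => // s _.
apply: (@measurableI _ TG); first exact: Gu.
by have := mg s measurableT _ mY; rewrite setTI.
Qed.

Lemma extension_measurable n j : measurable_fun setT (extension n j).
Proof.
move=> _ Y mY; rewrite setTI; apply: (@sigma_swap_invariant_measurable n).
apply: sigma_extension => // [i Z mZ|u].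
  exact: sigma_limit_frequency.
exact: sigma_cylinder.
Qed.

Lemma extension_integrable D n j : measurable D ->
  P.-integrable D (fun w => (extension n j w)%:E).
Proof.
move=> mD; apply: (@bounded_integrable _ _ _ P _ _ (1 + n%:R)) => //.
  exact: extension_measurable.
move=> w; apply: le_trans (extension_prob_bound _ _ _ _) _.
  by move=> i; exact: limit_frequency_itv.
by rewrite lerD2l ler_nat size_partition_shape_le.
Qed.

(** Splits B according to the first n labels, which form one of finitely many words. *)
Lemma integral_extension n j B : (0 < n)%N ->
  (forall i, (n <= i)%N -> <<s swap_invariant_events i >> B) ->
  (\int[P]_(w in B) (extension n j w)%:E = P (joins j n `&` B))%E.
Proof.
move=> n0 HB; have mB := sigma_swap_invariant_measurable (HB n (leqnn n)).
have mJ : measurable (joins j n) by exact: joins_measurable.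
pose F (s : {ffun 'I_n -> 'I_n}) := cylinder n (word_fun s) `&` B.
have mF s : measurable (F s).
  by apply: measurableI => //; exact: cylinder_measurable.
have BF : B = \big[setU/set0]_(s <- index_enum {ffun 'I_n -> 'I_n}) F s.
  rewrite -bigcup_seq; apply/seteqP; split => [w Bw|w [s _ []]//].
  have : (a @^-1` setT) w by [].
  rewrite (@event_bigcup n setT)// => -[s _ [sw _]].
  by exists s => //=; rewrite mem_index_enum.
have tF : trivIset [set` index_enum {ffun 'I_n -> 'I_n}] F.
  by apply: sub_trivIset (@trivIset_words n (fun=> B)).
rewrite -integral_indic// {1 2}BF !integral_bigsetU_EFin ?index_enum_uniq//.
- apply: eq_bigr => s _; rewrite integral_indic//.
  exact: integral_extension_cylinder.
- exact/measurable_EFinP/measurable_indic.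
- by apply/measurable_EFinP/measurable_funTS; exact: extension_measurable.
Qed.

End allocation.

Lemma admissible_cylinder rho u v n : (forall t, (t < n)%N -> u t = v t) ->
  admissible rho u n -> admissible rho v n.
Proof.
move=> uv adm i ni k; rewrite -uv// => ku.
by rewrite -(@eq_block_size u)=> [|t ti]; [exact: adm|rewrite uv// (ltn_trans ti)].
Qed.

(** * The label function of a constrained exchangeable partition *)

Section exchangeable_partition.
Context (d : measure_display) (T : measurableType d) (R : realType).
Variables (P : probability T R) (rho : nat -> nat) (Pi : T -> nat -> set nat).
Hypothesis rho_gt0 : forall k, (1 <= rho k)%N.
Hypothesis Pi_random : random_partition Pi.
Hypothesis Pi_exch : constrained_exchangeable P rho Pi.

Definition label (w : T) : nat -> nat := block_index (Pi w).

Lemma label_growth w : restricted_growth (label w).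
Proof. by apply: restricted_growth_index; have [+ _] := Pi_random; exact. Qed.

Lemma restriction_label n w : restriction n (Pi w) = blocks n (label w).
Proof. by apply: restriction_blocks; have [+ _] := Pi_random; exact. Qed.

Lemma cylinder_label n u :
  cylinder label n u = [set w | restriction n (Pi w) = blocks n u].
Proof.
by apply/seteqP; split => w; rewrite /= restriction_label eq_blocks.
Qed.

Lemma cylinder_label_measurable n u : measurable (cylinder label n u).
Proof. by rewrite cylinder_label; have [_] := Pi_random; exact. Qed.

Lemma joins_label j n : joins label j n = [set w | Pi w j n].
Proof.
apply/seteqP; split => w /=; have [/(_ w) PiT _] := Pi_random.
  by move=> /(block_indexP PiT _ I).
by move=> Pij; apply/(block_indexP PiT _ I).
Qed.

Lemma label_measurable i k : measurable [set w | label w i = k].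
Proof.
rewrite -[[set w | _]]/(label @^-1` [set u | u i = k]).
rewrite (event_bigcup label_growth (n := i.+1)); last first.
  by move=> u u' uu' /=; rewrite uu'.
apply: fin_bigcup_measurable => // s _.
have [H|H] := pselect ([set u : nat -> nat | u i = k] (word_fun s)).
  by rewrite (propT H) setIT; exact: cylinder_label_measurable.
by rewrite (propF H) setI0.
Qed.

Lemma label_admissible : {ae P, forall w, forall n, admissible rho (label w) n}.
Proof.
have [+ _] := Pi_exch; apply: filterS => w cw n.
by apply: constrained_admissible => //; have [+ _] := Pi_random; exact.
Qed.

Lemma inadmissible_null n u : ~ admissible rho u n -> P (cylinder label n u) = 0%E.
Proof.
move=> nadm; have [N [mN N0 subN]] := label_admissible.
apply: (@subset_measure0 _ _ _ P _ N) => //; first exact: cylinder_label_measurable.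
move=> w wu; apply: subN => /= adm; apply: nadm.
exact: admissible_cylinder (adm n).
Qed.

(** For an admissible u, both words encode constrained partitions of [n], each the image of the
    other under the transposition, so exchangeability applies. *)
Lemma label_cylinder_swap n i j u : (i.+1 < n)%N ->
  (rho j <= block_size u j i)%N -> u i = j \/ u i.+1 = j ->
  P (cylinder label n u) = P (cylinder label n (u \o swap i)).
Proof.
move=> iN full uij.
have [adm|nadm] := pselect (admissible rho u n).
  have adm' : admissible rho (u \o swap i) n by exact: admissible_swap full uij adm.
  have [_ exch] := Pi_exch; rewrite !cylinder_label -(image_swap_blocks _ iN).
  apply: exch; rewrite ?image_swap_blocks//.
  - exact: swap_bij.
  - exact: ordered_partition_blocks rho_gt0 adm.
  - exact: constrained_blocks.
  - exact: ordered_partition_blocks rho_gt0 adm'.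
  - exact: constrained_blocks.
(* Otherwise neither word is admissible, since swapping back would preserve admissibility, and both
   cylinders are null. *)
rewrite !inadmissible_null// => adm'; apply: nadm.
have -> : u = (u \o swap i) \o swap i by apply/funext => t /=; rewrite swapK.
apply: (@admissible_swap _ _ _ j) => //=; first by rewrite block_size_swap_le.
by rewrite swapL swapR; case: uij; [right|left].
Qed.

End exchangeable_partition.

Lemma sum_frequency_le1 (d : measure_display) (T : measurableType d)
    (R : realType) (a : T -> nat -> nat) J n (w : T) :
  \sum_(j < J) frequency R a j n w <= 1.
Proof.
rewrite /frequency -mulr_suml; have [->|n0] := posnP n.
  by rewrite invr0 mulr0.
rewrite ler_pdivrMr ?ltr0n// mul1r /block_size.
under eq_bigr do rewrite natr_sum.
rewrite exchange_big/=; apply: (@le_trans _ _ (\sum_(t < n) 1)); last first.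
  by rewrite sumr_const card_ord.
by apply: ler_sum => t _; rewrite sum_eq_ord; case: (_ < _)%N.
Qed.

Theorem proposition4 (d : measure_display) (T : measurableType d)
    (R : realType) (P : probability T R)
    (rho : nat -> nat) (Pi : T -> nat -> set nat) :
  (forall k, (1 <= rho k)%N) ->
  random_partition Pi ->
  constrained_exchangeable P rho Pi ->
  exists X : nat -> {RV P >-> R},
    {ae P, forall w,
      [/\ {ptws, (fun n => normalised_shape R n (restriction n (Pi w))) @ \oo
              --> (fun j => X j w)},
          (forall j, 0 <= X j w) &
          (\sum_(0 <= j <oo) (X j w)%:E <= 1)%E]} /\
    (forall n, (1 <= n)%N -> forall j,
      is_cond_prob P
        (sigma_limit_restriction (fun i => X i : T -> R) Pi n)
        [set w | Pi w j n]
        (fun w => extension_prob rho (fun i => X i w)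
                    (partition_shape n (restriction n (Pi w))) j)).
Proof.
move=> rho0 rPi ePi; pose a := label Pi.
have a_rg := label_growth rPi.
have ma := label_measurable rPi.
have ca := label_cylinder_swap rho0 rPi ePi.
have adm := label_admissible rPi ePi.
have mX j : measurable_fun setT (limit_frequency R a j).
  exact: limit_frequency_measurable.
pose X j : {RV P >-> R} :=
  HB.pack (limit_frequency R a j) (isMeasurableFun.Build _ _ _ _ _ (mX j)).
exists X; split.
  have := ae_cvg_frequency a_rg ma ca; apply: filterS => w [cw _].
  have X01 j := limit_frequency_itv R a j w.
  split.
  - apply/pointwise_cvgP => j.
    have shapeE : (fun n => normalised_shape R n (restriction n (Pi w)) j) =
        frequency R a j ^~ w.
      apply/funext => n; rewrite /normalised_shape restriction_label//.
      by rewrite nth_partition_shape.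
    by have := cw j; rewrite -shapeE.
  - by move=> j; have /andP[] := X01 j.
  - apply: lime_le.
      by apply: is_cvg_nneseries => j _ _; rewrite lee_fin; have /andP[] := X01 j.
    (* Each partial sum of limits is the limit of sums of frequencies of distinct blocks, which are
       at most 1. *)
    apply: nearW => J; rewrite sumEFin lee_fin big_mkord.
    have cvJ : (fun n => \sum_(j < J) frequency R a j n w) @ \oo -->
        \sum_(j < J) limit_frequency R a j w 
      by apply: cvg_big => [|j _]; [exact: add_continuous|exact: cw].
    by apply: (cvgr_to_le cvJ); apply: nearW => n; exact: sum_frequency_le1.
move=> n n1 j.
have fE : (fun w => extension_prob rho (fun i => X i w)
    (partition_shape n (restriction n (Pi w))) j) = extension R rho a n j.
  by apply/funext => w; rewrite /extension restriction_label.
rewrite fE; set G := sigma_limit_restriction _ _ _.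
(* The conditioning events qualify for [integral_extension]: swapping i and i+1 with i >= n changes
   neither the limit frequencies nor the restriction to [n]. *)
have GE : G `<=` (fun B => forall i, (n <= i)%N -> <<s swap_invariant_events a i >> B).
  move=> B GB i ni; move: B GB; apply: smallest_sub.
    exact: smallest_sigma_algebra.
  move=> _ [[k [Y [mY ->]]]|[pi ->]]; first exact: sigma_limit_frequency.
  apply: sub_sigma_algebra; exists n, [set u | blocks n u = pi]; split.
  - by move=> u u' uu' <-; apply/esym/eq_blocks.
  - move=> u <-; apply/eq_blocks => t tn /=; rewrite swap_id//; exact: leq_trans ni.
  - by apply/seteqP; split => w; rewrite /= restriction_label.
split.
- apply: sigma_extension => // [i Y mY|u]; apply: sub_sigma_algebra.
    by left; exists i, Y.
  by right; exists (blocks n u); rewrite cylinder_label.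
- exact: extension_integrable.
- move=> B GB; rewrite -joins_label//.
  by apply: integral_extension => //; exact: GE.
Qed.
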